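(* Let $p$ be a prime and $n\ge1$. The function $e_n:X_n\to\widetilde K_2(R_n)$ defined by $e_n(x,y)=\{1-\zeta_n^x,1-\zeta_n^y\}$ if $x\neq0$ and $y\neq0$, and $e_n(x,y)=0$ otherwise, is a Manin symbol over $\Gamma_0(p^n)$ (for the Artin nebentype character). Moreover, for $q\in\{2,3\}$ with $q\neq p$, $$e_n\big|\big(T_q-(q+\sigma_q)\big)\in\mathrm{Manin}^\infty_{\Gamma_0(p^n)}(\widetilde K_2(R_n)).$$
   Context: $\zeta_n$ is a primitive $p^n$-th root of unity, $R_n=\mathbb{Z}[\zeta_n,\tfrac1p]$, $G_n=\mathrm{Gal}(\mathbb{Q}(\zeta_n)/\mathbb{Q})$, and $\sigma_a\in G_n$ ($a\in(\mathbb{Z}/p^n\mathbb{Z})^\times$) satisfies $\sigma_a(\zeta_n)=\zeta_n^a$. $K_2^M(R_n)$ is Milnor's $K_2$ (generated by Steinberg symbols $\{a,b\}$, bimultiplicative, with $\{a,b\}=0$ when $a+b\in\{0,1\}$), written additively, and $\widetilde K_2(R_n)=K_2^M(R_n)/(2\text{-torsion})$ with its $G_n$-action. $X_n=\{(x,y)\in(\mathbb{Z}/p^n\mathbb{Z})^2:(x,y,p)=1\}$, a set of row vectors with right action of $SL_2(\mathbb{Z})$. The Artin nebentype character is $\chi:\Sigma_0(p^n)\to\mathbb{Z}[G_n]^\times$, $\chi\left(\begin{smallmatrix}a&b\\c&d\end{smallmatrix}\right)=\sigma_a$, where $\Sigma_0(p^n)=\{\left(\begin{smallmatrix}a&b\\c&d\end{smallmatrix}\right)\in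 M_2(\mathbb{Z}):\det>0,(a,p)=1,p^n\mid c\}$; $\Sigma_0(p^n)$ acts on $\widetilde K_2(R_n)$ by $m|\gamma=\chi(\gamma)m$; for $\lambda\in(\mathbb{Z}/p^n\mathbb{Z})^\times$ write $\chi(\lambda)=\sigma_\lambda$. A Manin symbol over $\Gamma_0(p^n)$ with values in $M=\widetilde K_2(R_n)$ is a function $e:X_n\to M$ such that for all $(x,y)\in X_n$ and $\lambda\in(\mathbb{Z}/p^n\mathbb{Z})^\times$: (1) $e(\lambda x,\lambda y)=\chi(\lambda)e(x,y)$; (2) $e(x,y)+e(y,-x)=0$; (3) $e(x,y)+e(y,-x-y)+e(-x-y,x)=0$. $\mathrm{Manin}^\infty_{\Gamma_0(p^n)}(M)$ is the subgroup of Manin symbols $e$ with $e(x,y)=0$ whenever $xy\neq0$. Hecke operators on Manin symbols: with $\Delta_0$ the degree-zero divisors on $\mathbb{P}^1(\mathbb{Q})$ and modular symbols $\mathrm{Symb}_{\Gamma_0(p^n)}(M)=\mathrm{Hom}(\Delta_0,M)^{\Gamma_0(p^n)}$ (action $(\phi|\sigma)(D)=\phi(\sigma D)|\sigma$), the map $\phi\mapsto e_\phi$, $e_\phi((0,1)\gamma)=\phi(\gamma((\infty)-(0)))$ for $\gamma\in SL_2(\mathbb{Z})$, is an isomorphism onto the Manin symbols (Manin), and $T_m$ on Manin symbols is transported from $\phi|T_m=\sum_i\phi|\delta_i$, $\delta_i$ running over left $\Gamma_0(p^n)$-coset representatives of $\Gamma_0(p^n)\left(\begin{smallmatrix}1&0\\0&m\end{smallmatrix}\right)\Gamma_0(p^n)$.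 By Merel's theorem, $(e|T_m)(\mathbf{x})=\sum_{\delta\in H_m}e(\mathbf{x}\delta)$, where $H_m$ is the set of integer matrices $\left(\begin{smallmatrix}a&b\\c&d\end{smallmatrix}\right)$ with $a>b\ge0$, $d>c\ge0$, $ad-bc=m$. *)

(* Defs.v *)
From HB Require Import structures.
From mathcomp Require Import all_boot all_order all_algebra.
From mathcomp Require Import all_fingroup all_solvable all_field.
From mathcomp Require Import generic_quotient ring_quotient.
From mathcomp Require Import boolp freeg.
From Stdlib Require Import ClassicalEpsilon.

Set Implicit Arguments.
Unset Strict Implicit.
Unset Printing Implicit Defensive.

Import GRing.Theory Num.Theory.
Import Quotient.Exports.

Local Open Scope ring_scope.
Local Open Scope quotient_scope.

Definition freeg_gen (K : choiceType) (x : K) : {freeg K / int} :=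
  [freeg [:: (1, x)]].

Definition freeg_map (K K' : choiceType) (f : K -> K') :
    {freeg K / int} -> {freeg K' / int} :=
  fglift (fun x => freeg_gen (f x)).

Lemma freeg_map_is_zmod_morphism (K K' : choiceType) (f : K -> K') :
  zmod_morphism (freeg_map f).
Proof. exact: lift_is_additive. Qed.

HB.instance Definition _ (K K' : choiceType) (f : K -> K') :=
  GRing.isZmodMorphism.Build {freeg K / int} {freeg K' / int} (freeg_map f)
    (freeg_map_is_zmod_morphism f).

Lemma freeg_map_gen (K K' : choiceType) (f : K -> K') (x : K) :
  freeg_map f (freeg_gen x) = freeg_gen (f x).
Proof. by rewrite /freeg_map /freeg_gen liftU scale1r. Qed.

Lemma deg_freeg_map (K K' : choiceType) (f : K -> K') (D : {freeg K / int}) :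
  deg (freeg_map f D) = deg D.
Proof.
elim/freeg_ind_dom0: D => [|k x D _ _ IHD]; first by rewrite !raddf0.
rewrite !raddfD /= IHD degU; congr (_ + _).
rewrite /freeg_map liftU /freeg_gen.
by rewrite -{1}[k]intz scaler_int raddfMz /= degU intz.
Qed.

(* The abelian group presented by the generators {a, b}, for a and b units of A,
   and the bimultiplicativity and Steinberg relations. *)
Section MilnorK2.

Context (A : comUnitRingType).

Definition units : Type := {x : A | x \is a GRing.unit}.
HB.instance Definition _ := Choice.on units.

Inductive steinberg_rel : {freeg (units * units)%type / int} -> Prop :=
| SteinbergMl (a b c d : units) : val d = val a * val b ->
    steinberg_rel (freeg_gen (d, c) - (freeg_gen (a, c) + freeg_gen (b, c)))
| SteinbergMr (a b c d : units) : val d = val b * val c ->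
    steinberg_rel (freeg_gen (a, d) - (freeg_gen (a, b) + freeg_gen (a, c)))
| Steinberg0 (a b : units) : val a + val b = 0 ->
    steinberg_rel (freeg_gen (a, b))
| Steinberg1 (a b : units) : val a + val b = 1 ->
    steinberg_rel (freeg_gen (a, b))
| SteinbergZ : steinberg_rel 0
| SteinbergB D E : steinberg_rel D -> steinberg_rel E -> steinberg_rel (D - E).

Definition steinberg_pred : {pred {freeg (units * units)%type / int}} :=
  fun D => `[< steinberg_rel D >].

Lemma steinberg_pred_zmod_closed : zmod_closed steinberg_pred.
Proof.
split=> [|D E /asboolP hD /asboolP hE]; first exact/asboolP/SteinbergZ.
exact/asboolP/SteinbergB.
Qed.

HB.instance Definition _ := GRing.isZmodClosed.Build
  {freeg (units * units)%type / int} steinberg_pred steinberg_pred_zmod_closed.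

Definition K2M : Type := Quotient.quot steinberg_pred.
HB.instance Definition _ := GRing.Zmodule.on K2M.
HB.instance Definition _ := Quotient.on K2M.

(* K2t A is the quotient of K2M A by its subgroup of elements killed by 2. *)
Definition tors2 : {pred K2M} := fun x => x *+ 2 == 0.

Lemma tors2_zmod_closed : zmod_closed tors2.
Proof.
split=> [|x y]; rewrite /tors2 !unfold_in ?mul0rn // => /eqP hx /eqP hy.
by rewrite mulrnBl hx hy subrr.
Qed.

HB.instance Definition _ := GRing.isZmodClosed.Build K2M tors2 tors2_zmod_closed.

Definition K2t : Type := Quotient.quot tors2.
HB.instance Definition _ := GRing.Zmodule.on K2t.
HB.instance Definition _ := Quotient.on K2t.

(* The image of {a, b} in K2t A; the value 0 is junk if a or b is not a unit. *)
Definition steinberg (a b : A) : K2t :=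
  if (insub a : option units, insub b : option units) is (Some u, Some v)
  then \pi_K2t (\pi_K2M (freeg_gen (u, v))) else 0.

Lemma piK2t_eq0 (x : K2M) : \pi_K2t x = 0 <-> x *+ 2 = 0.
Proof.
rewrite -[X in _ = X](raddf0 \pi_K2t).
split=> [/eqP|h]; first by rewrite -Quotient.idealrBE subr0 => /eqP.
by apply/eqP; rewrite -Quotient.idealrBE subr0; apply/eqP.
Qed.

End MilnorK2.

Section Functoriality.

Context (A B : comUnitRingType) (f : {rmorphism A -> B}).

Definition units_map (u : units A) : units B :=
  Sub (f (val u)) (rmorph_unit f (valP u)).

(* The choice of representatives is irrelevant: see K2M_mapE and K2t_mapE. *)
Definition K2M_map (x : K2M A) : K2M B :=
  \pi_(K2M B) (freeg_map (fun uv => (units_map uv.1, units_map uv.2)) (repr x)).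

Definition K2t_map (x : K2t A) : K2t B := \pi_(K2t B) (K2M_map (repr x)).

Lemma steinberg_rel_map D : steinberg_rel D ->
  steinberg_rel (freeg_map (fun uv => (units_map uv.1, units_map uv.2)) D).
Proof.
elim=> [a b c d h|a b c d h|a b h|a b h||E F _ hE _ hF];
  rewrite ?raddf0 ?raddfB ?raddfD /= ?freeg_map_gen /=.
- by rewrite -opprD; apply: SteinbergMl; rewrite /= h rmorphM.
- by rewrite -opprD; apply: SteinbergMr; rewrite /= h rmorphM.
- by apply: Steinberg0; rewrite /= -rmorphD h rmorph0.
- by apply: Steinberg1; rewrite /= -rmorphD h rmorph1.
- exact: SteinbergZ.
- exact: SteinbergB.
Qed.

Lemma K2M_mapE D : K2M_map (\pi_(K2M A) D) =
  \pi_(K2M B) (freeg_map (fun uv => (units_map uv.1, units_map uv.2)) D).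
Proof.
rewrite /K2M_map; apply/eqP; rewrite -Quotient.idealrBE -raddfB.
apply/asboolP/steinberg_rel_map.
have : repr (\pi_(K2M A) D) - D \in @steinberg_pred A.
  by rewrite Quotient.idealrBE reprK.
by move/asboolP.
Qed.

Lemma K2M_mapD : {morph K2M_map : x y / x + y}.
Proof.
by elim/quotW=> x; elim/quotW=> y; rewrite -raddfD !K2M_mapE !raddfD.
Qed.

Lemma K2t_mapE x : K2t_map (\pi_(K2t A) x) = \pi_(K2t B) (K2M_map x).
Proof.
pose u := repr (\pi_(K2t A) x) - x.
have u2 : u *+ 2 = 0 by apply/piK2t_eq0; rewrite raddfB /= reprK subrr.
have -> : K2t_map (\pi_(K2t A) x) = \pi_(K2t B) (K2M_map (x + u)).
  by rewrite /u addrC subrK.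
rewrite K2M_mapD raddfD /= [X in _ + X](_ : _ = 0) ?addr0 //.
have K0 : K2M_map 0 = 0.
  by apply: (addrI (K2M_map 0)); rewrite -K2M_mapD !addr0.
by apply/piK2t_eq0; rewrite mulr2n -K2M_mapD -mulr2n u2.
Qed.

Lemma K2t_map_steinberg (a b : A) :
  a \is a GRing.unit -> b \is a GRing.unit ->
  K2t_map (steinberg a b) = steinberg (f a) (f b).
Proof.
move=> ha hb; have hfa := rmorph_unit f ha; have hfb := rmorph_unit f hb.
rewrite /steinberg !insubT K2t_mapE K2M_mapE freeg_map_gen /=.
by congr (\pi_(K2t B) (\pi_(K2M B) (freeg_gen (_, _)))); apply: val_inj.
Qed.

End Functoriality.

Section CyclotomicRing.

Context (L : splittingFieldType rat) (p : nat) (z : L).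

(* Z[z, 1/p], the subring of L generated by z and 1/p. *)
Inductive in_Rn : L -> Prop :=
| RnZeta : in_Rn z
| RnPV : in_Rn (p%:R^-1)
| Rn1 : in_Rn 1
| RnB x y : in_Rn x -> in_Rn y -> in_Rn (x - y)
| RnM x y : in_Rn x -> in_Rn y -> in_Rn (x * y).

Definition Rn_pred : {pred L} := fun x => `[< in_Rn x >].

Lemma Rn_pred_subring_closed : subring_closed Rn_pred.
Proof.
split=> [|x y /asboolP hx /asboolP hy|x y /asboolP hx /asboolP hy];
  apply/asboolP; [exact: Rn1|exact: RnB|exact: RnM].
Qed.

HB.instance Definition _ :=
  GRing.isSubringClosed.Build L Rn_pred Rn_pred_subring_closed.

Record Rn : Type := MkRn { Rn_val : L; _ : Rn_val \in Rn_pred }.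

HB.instance Definition _ := [isSub for Rn_val].
HB.instance Definition _ := [Choice of Rn by <:].
HB.instance Definition _ := [SubChoice_isSubComNzRing of Rn by <:].

Definition Rn_unit : {pred Rn} :=
  fun x => (val x != 0) && ((val x)^-1 \in Rn_pred).
Definition Rn_inv (x : Rn) : Rn :=
  if x \in Rn_unit then insubd x (val x)^-1 else x.

Lemma Rn_mulVx : {in Rn_unit, left_inverse 1 Rn_inv *%R}.
Proof.
move=> x xU; have /andP[x0 xV] := xU.
by apply: val_inj; rewrite /= /Rn_inv xU val_insubd xV mulVf.
Qed.

Lemma Rn_unitP (x y : Rn) : y * x = 1 -> x \in Rn_unit.
Proof.
move=> /(congr1 val) /= yx1.
have x0 : val x != 0.
  by apply: contra_eq_neq yx1 => ->; rewrite mulr0 eq_sym oner_neq0.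
apply/andP; split=> //.
by rewrite -[_^-1]mul1r -yx1 mulfK // (valP y).
Qed.

Lemma Rn_inv_out : {in [predC Rn_unit], Rn_inv =1 id}.
Proof. by move=> x /= xNU; rewrite /Rn_inv ifN. Qed.

HB.instance Definition _ :=
  GRing.ComNzRing_hasMulInverse.Build Rn Rn_mulVx Rn_unitP Rn_inv_out.

Definition zetaR : Rn := MkRn (introT (asboolP _) RnZeta).

Section Galois.

Context (N : nat) (hz : N.-primitive_root z).

Lemma gal_Rn (g : gal_of {:L}) (x : L) : x \in Rn_pred -> g x \in Rn_pred.
Proof.
move=> /asboolP; elim=> {x} [|||x y _ IHx _ IHy|x y _ IHx _ IHy].
- have gz1 : g z ^+ N = 1 by rewrite -rmorphXn /= (prim_expr_order hz) rmorph1.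
  have [i ->] := prim_rootP hz gz1.
  by apply: rpredX; apply/asboolP/RnZeta.
- by rewrite fmorphV rmorph_nat; apply/asboolP/RnPV.
- by rewrite rmorph1 rpred1.
- by rewrite rmorphB rpredB.
- by rewrite rmorphM rpredM.
Qed.

Definition galR (g : gal_of {:L}) (x : Rn) : Rn := MkRn (gal_Rn g (valP x)).

Lemma galR_is_zmod_morphism g : zmod_morphism (galR g).
Proof. by move=> x y; apply: val_inj; rewrite /= rmorphB. Qed.

Lemma galR_is_monoid_morphism g : monoid_morphism (galR g).
Proof.
by split=> [|x y]; apply: val_inj; rewrite /= ?rmorph1 ?rmorphM.
Qed.

HB.instance Definition _ g :=
  GRing.isZmodMorphism.Build Rn Rn (galR g) (galR_is_zmod_morphism g).
HB.instance Definition _ g :=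
  GRing.isMonoidMorphism.Build Rn Rn (galR g) (galR_is_monoid_morphism g).

(* When L = Q(z) and a is prime to N, there is exactly one such g; the default
   value is only reached for other a. *)
Definition sigma (a : 'Z_N) : gal_of {:L} :=
  odflt 1%g [pick g in ('Gal({:L} / 1))%g | g z == z ^+ a].

Definition sigmaK2 (a : 'Z_N) : K2t Rn -> K2t Rn := K2t_map (galR (sigma a)).

End Galois.

(* 1 - z^x divides a power of p in Z[z] for x <> 0, hence is a unit of Rn. *)
Definition cyclo_symbol (N : nat) (x y : 'Z_N) : K2t Rn :=
  if (x != 0) && (y != 0) then steinberg (1 - zetaR ^+ x) (1 - zetaR ^+ y)
  else 0.

End CyclotomicRing.

(* P^1(Q), with None the point at infinity. *)
Notation P1Q := (option rat).

Definition mobius (g : 'M[int]_2) (r : P1Q) : P1Q :=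
  let: (u, v) := if r is Some t then (t, 1) else (1, 0) in
  let num := (g 0 0)%:~R * u + (g 0 1)%:~R * v in
  let den := (g 1 0)%:~R * u + (g 1 1)%:~R * v in
  if den == 0 then None else Some (num / den).

Definition deg0_pred : {pred {freeg P1Q / int}} := fun D => deg D == 0.

Lemma deg0_pred_zmod_closed : zmod_closed deg0_pred.
Proof.
split=> [|D E]; rewrite /deg0_pred !unfold_in ?deg0 // => /eqP hD /eqP hE.
by rewrite degB hD hE subrr.
Qed.

HB.instance Definition _ := GRing.isZmodClosed.Build
  {freeg P1Q / int} deg0_pred deg0_pred_zmod_closed.

Record div0 : Type := Div0 { div0_val : {freeg P1Q / int}; _ : div0_val \in deg0_pred }.

HB.instance Definition _ := [isSub for div0_val].
HB.instance Definition _ := [Choice of div0 by <:].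
HB.instance Definition _ := [SubChoice_isSubZmodule of div0 by <:].

Lemma div0_act_subproof (g : 'M[int]_2) (D : div0) :
  freeg_map (mobius g) (val D) \in deg0_pred.
Proof. by rewrite unfold_in /deg0_pred deg_freeg_map; exact: valP D. Qed.

Definition div0_act (g : 'M[int]_2) (D : div0) : div0 :=
  Div0 (div0_act_subproof g D).

Lemma div_inf_0_subproof :
  freeg_gen (None : P1Q) - freeg_gen (Some 0 : P1Q) \in deg0_pred.
Proof. by rewrite unfold_in /deg0_pred degB !degU subrr. Qed.

Definition div_inf_0 : div0 := Div0 div_inf_0_subproof.

Definition mx2 (a b c d : int) : 'M[int]_2 :=
  \matrix_(i, j) if i == 0 then (if j == 0 then a else b)
                 else (if j == 0 then c else d).

Definition Gamma0 (N : nat) (g : 'M[int]_2) : Prop :=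
  \det g = 1 /\ (N%:Z %| g 1%R 0%R)%Z.

Definition double_coset (N m : nat) (d : 'M[int]_2) : Prop :=
  exists g h, [/\ Gamma0 N g, Gamma0 N h & d = g *m mx2 1 0 0 m%:Z *m h].

(* A finite system of representatives of Gamma0 \ (Gamma0 diag(1, m) Gamma0);
   phi | T_m does not depend on it, since phi | g = phi for g in Gamma0. *)
Definition is_coset_reps (N m : nat) (s : seq 'M[int]_2) : Prop :=
  [/\ uniq s, forall d, d \in s -> double_coset N m d
    & forall d, double_coset N m d ->
        exists! e, e \in s /\ exists2 g, Gamma0 N g & d = g *m e].

Definition coset_reps (N m : nat) : seq 'M[int]_2 :=
  epsilon (inhabits [::]) (is_coset_reps N m).

Section ManinSymbols.

(* act l is multiplication by chi(l) on M, for l in (Z/p^n)^x; only the values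
   of act at units are relevant. *)
Context (p n : nat) (M : zmodType) (act : 'Z_(p ^ n) -> M -> M).

Implicit Types (e : 'Z_(p ^ n) -> 'Z_(p ^ n) -> M) (phi : div0 -> M).

Definition in_Xn (x y : 'Z_(p ^ n)) : bool := gcdn (gcdn x y) p == 1%N.

(* Only the values of e on X_n are relevant. *)
Definition is_manin e : Prop :=
  forall x y, in_Xn x y ->
  [/\ forall l, l \is a GRing.unit -> e (l * x) (l * y) = act l (e x y),
      e x y + e y (- x) = 0
    & e x y + e y (- x - y) + e (- x - y) x = 0].

Definition is_manin_inf e : Prop :=
  is_manin e /\ forall x y, in_Xn x y -> x * y != 0 -> e x y = 0.

Definition slash phi (g : 'M[int]_2) : div0 -> M :=
  fun D => act (g 0 0)%:~R (phi (div0_act g D)).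

Definition is_modsymb phi : Prop :=
  zmod_morphism phi /\ forall g, Gamma0 (p ^ n) g -> slash phi g =1 phi.

(* Some g in SL_2(Z) with (0, 1) g = (x, y) mod p^n; the value manin_of phi x y
   does not depend on its choice when phi is a modular symbol. *)
Definition lift_SL2 (x y : 'Z_(p ^ n)) : 'M[int]_2 :=
  epsilon (inhabits 1%:M)
    (fun g => [/\ \det g = 1, (g 1 0)%:~R = x & (g 1 1)%:~R = y]).

Definition manin_of phi : 'Z_(p ^ n) -> 'Z_(p ^ n) -> M :=
  fun x y => phi (div0_act (lift_SL2 x y) div_inf_0).

(* The inverse of Manin's isomorphism phi |-> manin_of phi. *)
Definition modsymb_of e : div0 -> M :=
  epsilon (inhabits (fun=> 0)) (fun phi =>
    is_modsymb phi /\ forall x y, in_Xn x y -> manin_of phi x y = e x y).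

Definition hecke_modsymb (m : nat) phi : div0 -> M :=
  fun D => \sum_(d <- coset_reps (p ^ n) m) slash phi d D.

Definition hecke (m : nat) e : 'Z_(p ^ n) -> 'Z_(p ^ n) -> M :=
  manin_of (hecke_modsymb m (modsymb_of e)).

End ManinSymbols.

Arguments is_manin p n {M} act e.
Arguments is_manin_inf p n {M} act e.
Arguments hecke p n {M} act m e x y.
Arguments cyclo_symbol {L} p z N x y.

(* Main.v *)
Require Import Defs.
From HB Require Import structures.
From mathcomp Require Import all_boot all_order all_algebra.
From mathcomp Require Import all_fingroup all_solvable all_field.
From mathcomp Require Import generic_quotient ring_quotient boolp freeg.
From mathcomp Require Import zify ring.
From Stdlib Require Import ClassicalEpsilon.

Set Implicit Arguments.
Unset Strict Implicit.
Unset Printing Implicit Defensive.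

Import Order.TTheory GRing.Theory Num.Theory.
Import Quotient.Exports.

Local Open Scope ring_scope.
Local Open Scope quotient_scope.

                                            

(** Modulo 2-torsion the symbol is antisymmetric, with {-1, u} = 0 and {u, u} = 0. Moreover {zeta, 1
    - zeta^x} = 0 whenever zeta^x is not 1 ([orth_zeta1]): for x prime to p this symbol is killed
    both by x and by p^n, and in general 1 - zeta^x is a product of elements 1 - zeta^y with y prime
    to p. Hence signs and powers of zeta are invisible in all symbols at hand ([flat] against
    [orth]), and a linear relation t u + t' v = w with such coefficients t, t' gives {u, v} = {u, w}
    + {w, v} ([steinberg3]).

    Applied to (1 - X) + X (1 - Y) = 1 - X Y, this is the three-term Manin relation
    ([cyclo_triangle], [cyclo_symbol_manin]). Equivariance under sigma_l rests on zeta having every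
    zeta^l, l prime to p, as a conjugate ([root_minPoly_prim_root]).

    Equivariance turns sigma_q e(x, y) into e(qx, qy), so the Hecke claim reads (T_q e)(x, y) = q
    e(x, y) + e(qx, qy). Merel's formula has four terms for q = 2 and seven for q = 3 ([hecke2E],
    [hecke3E]). The identity then follows from a few instances of [steinberg3] and the factorisation
    of 1 - X^q ([cyclo_hecke2], [cyclo_hecke3]); the cases where an intermediate argument such as x
    + y vanishes are treated apart.

    Since [hecke] is defined through modular symbols and chosen representatives, these formulas have
    to be derived. A Manin symbol is integrated along the Farey graph to a modular symbol
    ([potential_edge], [modsymb_of_manin]). For g in SL_2(Z), the cosets of T_q have representatives
    l h g^-1 of trivial character, with h in Hermite form and l in SL_2(Z) ([hecke_coset_reps]), and
    they send g(inf - 0) to l h(inf - 0). Cutting h(inf - 0) into unimodular paths gives the terms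
    of the formula ([hecke_term]). *)

(** * Linear identities in abelian groups, by reflection *)

Inductive zexpr :=
  | ZVar of nat | ZZero | ZAdd of zexpr & zexpr | ZOpp of zexpr
  | ZMuln of zexpr & nat.

Fixpoint zeval (M : zmodType) (v : seq M) (e : zexpr) : M :=
  match e with
  | ZVar i => v`_i
  | ZZero => 0
  | ZAdd e f => zeval v e + zeval v f
  | ZOpp e => - zeval v e
  | ZMuln e n => zeval v e *+ n
  end.

Fixpoint zcoef (e : zexpr) (i : nat) : int :=
  match e with
  | ZVar j => (j == i)%:Z
  | ZZero => 0
  | ZAdd e f => zcoef e i + zcoef f i
  | ZOpp e => - zcoef e i
  | ZMuln e n => zcoef e i * n%:Z
  end.

Lemma zevalE (M : zmodType) (v : seq M) (e : zexpr) :
  zeval v e = \sum_(i < size v) v`_i *~ zcoef e i.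
Proof.
elim: e => [j||e IHe f IHf|e IHe|e IHe n] /=.
- have [lt_j|ge_j] := ltnP j (size v); last first.
    rewrite nth_default // big1 // => i _.
    by rewrite gtn_eqF ?mulr0z // (leq_trans (ltn_ord i)).
  rewrite (bigD1 (Ordinal lt_j)) //= eqxx mulr1z big1 ?addr0 // => i ne_ij.
  by rewrite [j == i]eq_sym; move: ne_ij; rewrite -val_eqE /= => /negPf ->.
- by rewrite big1.
- by rewrite IHe IHf -big_split; apply: eq_bigr => i _; rewrite mulrzDr.
- by rewrite IHe -sumrN; apply: eq_bigr => i _; rewrite mulrNz.
- by rewrite IHe -sumrMnl; apply: eq_bigr => i _; rewrite mulrzA pmulrn.
Qed.

Lemma zeval_eq (M : zmodType) (v : seq M) (e f : zexpr) :
  all (fun i => zcoef e i == zcoef f i) (iota 0 (size v)) ->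
  zeval v e = zeval v f.
Proof.
move=> /allP eq_ef; rewrite !zevalE; apply: eq_bigr => i _; congr (_ *~ _).
by apply/eqP/eq_ef; rewrite mem_iota /= ltn_ord.
Qed.

Ltac zmod_index x v :=
  lazymatch v with
  | x :: _ => constr:(0%N)
  | _ :: ?w => let n := zmod_index x w in constr:(S n)
  end.

Ltac zmod_add x v :=
  let rec mem w :=
    lazymatch w with
    | [::] => constr:(false) | x :: _ => constr:(true) | _ :: ?w' => mem w'
    end in
  lazymatch mem v with true => v | _ => constr:(x :: v) end.

Ltac zmod_vars t v :=
  lazymatch t with
  | GRing.add ?a ?b => let w := zmod_vars a v in zmod_vars b w
  | GRing.opp ?a => zmod_vars a v
  | GRing.natmul ?a _ => zmod_vars a v
  | GRing.zero => v
  | _ => zmod_add t v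
  end.

Ltac zmod_quote t v :=
  lazymatch t with
  | GRing.add ?a ?b =>
      let e := zmod_quote a v in let f := zmod_quote b v in constr:(ZAdd e f)
  | GRing.opp ?a => let e := zmod_quote a v in constr:(ZOpp e)
  | GRing.natmul ?a ?n => let e := zmod_quote a v in constr:(ZMuln e n)
  | GRing.zero => constr:(ZZero)
  | _ => let n := zmod_index t v in constr:(ZVar n)
  end.

(** Maximal subterms that are not sums, opposites or multiples become variables; the integer
    coefficients of both sides are then compared by computation. *)
Ltac zmod :=
  lazymatch goal with
  | |- @eq ?T ?a ?b =>
    let v0 := constr:(@nil T) in
    let v1 := zmod_vars a v0 in
    let v := zmod_vars b v1 in
    let e := zmod_quote a v in
    let f := zmod_quote b v in
    apply: (@zeval_eq _ v e f); vm_compute; reflexivity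
  end.

(** Feeds a hypothesis to [zmod], which by itself only proves identities valid in every abelian
    group: [l = r] is added crosswise to the goal, and after all hypotheses have been added the goal
    is a formal identity. *)
Lemma eq_add_hyp (M : zmodType) (l r x y : M) : l = r -> x + r = y + l -> x = y.
Proof. by move=> -> /addIr. Qed.

                                           

(** * Steinberg symbols modulo 2-torsion *)

Section SteinbergSymbols.

Context (A : comUnitRingType).
Implicit Types a b c t u v w : A.

Local Notation unit u := (u \is a GRing.unit).

Lemma steinberg_eq0 (D : {freeg (units A * units A)%type / int}) :
  steinberg_rel D -> \pi_(K2M A) D = 0.
Proof.
move=> hD; rewrite -[RHS](raddf0 \pi_(K2M A)); apply/eqP.
by rewrite -Quotient.idealrBE subr0; apply/asboolP.
Qed.

Lemma steinbergE (u v : units A) :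
  steinberg (val u) (val v) = \pi_(K2t A) (\pi_(K2M A) (freeg_gen (u, v))).
Proof. by rewrite /steinberg !valK. Qed.

Lemma steinbergMl a b c : unit a -> unit b -> unit c ->
  steinberg (a * b) c = steinberg a c + steinberg b c.
Proof.
move=> ua ub uc; have uab : unit (a * b) by rewrite unitrM ua.
pose U x (ux : unit x) : units A := Sub x ux.
rewrite -[a * b]/(val (U _ uab)) -[a]/(val (U _ ua)) -[b]/(val (U _ ub)).
rewrite -[c]/(val (U _ uc)) !steinbergE -raddfD /=.
congr (\pi_(K2t A) _); apply/eqP; rewrite -subr_eq0 -raddfD -raddfB /=.
by apply/eqP/steinberg_eq0; apply: SteinbergMl.
Qed.

Lemma steinbergMr a b c : unit a -> unit b -> unit c ->
  steinberg a (b * c) = steinberg a b + steinberg a c.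
Proof.
move=> ua ub uc; have ubc : unit (b * c) by rewrite unitrM ub.
pose U x (ux : unit x) : units A := Sub x ux.
rewrite -[b * c]/(val (U _ ubc)) -[a]/(val (U _ ua)) -[b]/(val (U _ ub)).
rewrite -[c]/(val (U _ uc)) !steinbergE -raddfD /=.
congr (\pi_(K2t A) _); apply/eqP; rewrite -subr_eq0 -raddfD -raddfB /=.
by apply/eqP/steinberg_eq0; apply: SteinbergMr.
Qed.

Lemma steinberg_add0 a b : unit a -> unit b -> a + b = 0 -> steinberg a b = 0.
Proof.
move=> ua ub ab0; pose U x (ux : unit x) : units A := Sub x ux.
rewrite -[a]/(val (U _ ua)) -[b]/(val (U _ ub)) steinbergE.
by rewrite steinberg_eq0 ?raddf0 //; apply: Steinberg0.
Qed.

Lemma steinberg_add1 a b : unit a -> unit b -> a + b = 1 -> steinberg a b = 0.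
Proof.
move=> ua ub ab1; pose U x (ux : unit x) : units A := Sub x ux.
rewrite -[a]/(val (U _ ua)) -[b]/(val (U _ ub)) steinbergE.
by rewrite steinberg_eq0 ?raddf0 //; apply: Steinberg1.
Qed.

Lemma steinberg1l a : unit a -> steinberg 1 a = 0.
Proof.
move=> ua; apply: (addrI (steinberg 1 a)).
by rewrite -steinbergMl ?unitr1 // mulr1 addr0.
Qed.

(** Expand {ab, -ab} = 0 and cancel {a, -a} and {b, -b}. *)
Lemma steinbergC a b : unit a -> unit b -> steinberg a b = - steinberg b a.
Proof.
move=> ua ub; have uNa : unit (- a) by rewrite unitrN.
have uNb : unit (- b) by rewrite unitrN.
apply/eqP; rewrite -addr_eq0; apply/eqP.
have : steinberg (a * b) (- a * b) = 0.
  by apply: steinberg_add0; rewrite ?unitrM ?ua ?uNa ?mulNr ?subrr.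
rewrite steinbergMl ?unitrM ?uNa // steinbergMr // mulNr -mulrN steinbergMr //.
rewrite [steinberg a (- a)]steinberg_add0 ?subrr //.
by rewrite [steinberg b (- b)]steinberg_add0 ?subrr // add0r addr0.
Qed.

(** In [K2M] twice {-1, a} is {1, a} = 0, so {-1, a} is 2-torsion and dies in [K2t]. This is what
    passing to the quotient buys. *)
Lemma steinbergN1l a : unit a -> steinberg (- 1) a = 0.
Proof.
move=> ua; have uN1 : unit (- 1 : A) by rewrite unitrN1.
pose U x (ux : unit x) : units A := Sub x ux.
rewrite -[a]/(val (U _ ua)) -[- 1]/(val (U _ uN1)) steinbergE.
apply/piK2t_eq0; rewrite mulr2n.
have pi_mul (x y w : units A) : val w = val x * val y ->
    \pi_(K2M A) (freeg_gen (w, U _ ua))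
    = \pi_(K2M A) (freeg_gen (x, U _ ua)) + \pi_(K2M A) (freeg_gen (y, U _ ua)).
  move=> ew; apply: subr0_eq.
  rewrite -(steinberg_eq0 (SteinbergMl (U _ ua) ew)) raddfB /=.
  by congr (_ - _); rewrite raddfD.
have e1 := pi_mul (U _ (unitr1 A)) (U _ (unitr1 A)) (U _ (unitr1 A)) (esym (mulr1 1)).
rewrite -(pi_mul _ _ (U _ (unitr1 A))) /= ?mulN1r ?opprK //.
by apply: (addrI (\pi_(K2M A) (freeg_gen (U _ (unitr1 A), U _ ua)))); rewrite -e1 addr0.
Qed.

Lemma steinbergrr a : unit a -> steinberg a a = 0.
Proof.
move=> ua; rewrite -{2}[a]opprK -mulN1r steinbergMr ?unitrN ?unitr1 //.
by rewrite steinbergC ?unitrN1 // steinbergN1l // steinberg_add0 ?unitrN ?subrr // oppr0 addr0.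
Qed.

Lemma steinbergVl a b : unit a -> unit b -> steinberg a^-1 b = - steinberg a b.
Proof.
move=> ua ub; apply/eqP; rewrite -addr_eq0.
by rewrite -steinbergMl ?unitrV // mulVr // steinberg1l.
Qed.

Lemma steinbergXl a b n : unit a -> unit b ->
  steinberg (a ^+ n) b = steinberg a b *+ n.
Proof.
move=> ua ub; elim: n => [|n IHn]; first by rewrite steinberg1l.
by rewrite exprS mulrS steinbergMl ?unitrX // IHn.
Qed.

                                                                                
                                                                               
(** * Symbols insensitive to powers of a fixed unit *)

Context (z : A) (uz : unit z).

(** Here [z] stands for the root of unity; every nonzero 1 - zeta^x will be shown to lie in this
    subgroup of units. *)
Definition orth u := unit u /\ steinberg z u = 0.

Definition flat t := unit t /\ forall u, orth u -> steinberg t u = 0.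

Lemma orthU u : orth u -> unit u. Proof. by case. Qed.

Lemma orth1 : orth 1.
Proof. by split; rewrite ?unitr1 // steinbergC ?unitr1 // steinberg1l ?oppr0. Qed.

Lemma orthM u v : orth u -> orth v -> orth (u * v).
Proof.
by move=> [uu zu] [uv zv]; split; rewrite ?unitrM ?uu // steinbergMr // zu zv addr0.
Qed.

Lemma orthV u : orth u -> orth u^-1.
Proof.
move=> [uu zu]; split; rewrite ?unitrV //.
by rewrite steinbergC ?unitrV // steinbergVl // -steinbergC // zu oppr0.
Qed.

(** Gives access to cofactors such as 1 + X and 1 + X + X^2, known only through the factorisation of
    1 - X^2 or 1 - X^3. *)
Lemma orthMKl u v : orth u -> orth (u * v) -> orth v.
Proof.
by move=> ou ouv; rewrite -[v](mulKr (orthU ou)); apply: orthM ouv; apply: orthV.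
Qed.

Lemma flat1 : flat 1.
Proof. by split=> [|u [uu _]]; rewrite ?unitr1 // steinberg1l. Qed.

Lemma flatz : flat z. Proof. by split=> // u []. Qed.

Lemma flatM t u : flat t -> flat u -> flat (t * u).
Proof.
move=> [ut ht] [uu hu]; split=> [|v ov]; first by rewrite unitrM ut.
by rewrite steinbergMl ?ht ?hu ?addr0 ?(orthU ov).
Qed.

Lemma flatN t : flat t -> flat (- t).
Proof.
rewrite -mulN1r; apply: flatM; split=> [|u [uu _]]; first exact: unitrN1.
exact: steinbergN1l.
Qed.

Lemma flatX t n : flat t -> flat (t ^+ n).
Proof.
by move=> ft; elim: n => [|n IHn]; [exact: flat1 | rewrite exprS; exact: flatM].
Qed.

Lemma flat_orth t : flat t -> orth t.
Proof.
have oz : orth z by split=> //; exact: steinbergrr.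
by move=> [ut ht]; split=> //; rewrite steinbergC // ht // oppr0.
Qed.

Lemma steinberg_flatMl t u v : flat t -> orth u -> orth v ->
  steinberg (t * u) v = steinberg u v.
Proof. by move=> [ut ht] [uu _] ov; rewrite steinbergMl ?(orthU ov) // ht // add0r. Qed.

Lemma steinberg_flatMr t u v : flat t -> orth u -> orth v ->
  steinberg u (t * v) = steinberg u v.
Proof.
move=> ft ou ov; have [ut uu uv] := And3 (proj1 ft) (orthU ou) (orthU ov).
by rewrite steinbergC ?unitrM ?ut // steinberg_flatMl // -steinbergC.
Qed.

(** Dividing by w gives the Steinberg relation {t u / w, t' v / w} = 0; when it is expanded, t and
    t' drop out because they are flat, and {w, w} = 0. *)
Lemma steinberg3 t t' u v w : flat t -> flat t' -> orth u -> orth v -> orth w ->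
  t * u + t' * v = w -> steinberg u v = steinberg u w + steinberg w v.
Proof.
move=> ft ft' ou ov ow eq_w; have [uu uv uw] := And3 (orthU ou) (orthU ov) (orthU ow).
have [ot ot'] := (flat_orth ft, flat_orth ft').
have oVw := orthV ow.
have otu := orthM (orthM ot ou) oVw; have otv := orthM (orthM ot' ov) oVw.
have : steinberg (t * u / w) (t' * v / w) = 0.
  by apply: steinberg_add1; rewrite ?(orthU otu) ?(orthU otv) // -mulrDl eq_w divrr.
have [ut ut'] := (orthU ot, orthU ot').
rewrite steinbergMl ?(orthU (orthM ot ou)) ?unitrV ?(orthU otv) //.
rewrite steinbergVl ?(orthU otv) // steinberg_flatMl //.
rewrite !steinbergMr ?unitrM ?ut' ?unitrV //.
rewrite ![steinberg _ w^-1]steinbergC ?unitrV // !steinbergVl //.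
rewrite steinbergrr // [steinberg w u]steinbergC //.
rewrite [steinberg u t']steinbergC // (proj2 ft') //.
rewrite [steinberg w t']steinbergC // (proj2 ft') // => h.
by apply: (eq_add_hyp h); zmod.
Qed.

Lemma steinberg3_1 t t' u v : flat t -> flat t' -> orth u -> orth v ->
  t * u + t' * v = 1 -> steinberg u v = 0.
Proof.
move=> ft ft' ou ov eq1; rewrite (steinberg3 ft ft' ou ov orth1 eq1).
have [uu uv] := (orthU ou, orthU ov).
by rewrite steinberg1l // steinbergC ?unitr1 // steinberg1l // oppr0 addr0.
Qed.

Lemma cyclo_triangle X Y : flat X -> orth (1 - X) -> orth (1 - Y) ->
  orth (1 - X * Y) ->
  steinberg (1 - X) (1 - Y)
    = steinberg (1 - X) (1 - X * Y) + steinberg (1 - X * Y) (1 - Y).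
Proof. by move=> fX oX oY oXY; apply: (steinberg3 flat1 fX) => //; ring. Qed.

                                                                  
(** * Hecke identities between the symbols of 1 - X and 1 - Y *)

(** With X = zeta^x and Y = zeta^y the left side is T_2 in Merel's form. After splitting 1 - X^2 and
    1 - Y^2, the claim is the sum of two triangles through 1 - X Y: the one for 1 - X, 1 - Y, and
    its image under X -> -X, Y -> -Y, coming from (1 + X) - X (1 + Y) = 1 - X Y. *)
Lemma cyclo_hecke2 X Y : flat X -> flat Y ->
  orth (1 - X) -> orth (1 - Y) -> orth (1 - X * Y) ->
  orth (1 - X ^+ 2) -> orth (1 - Y ^+ 2) ->
  steinberg (1 - X) (1 - Y ^+ 2) + steinberg (1 - X ^+ 2) (1 - Y)
  + steinberg (1 - X ^+ 2) (1 - X * Y) + steinberg (1 - X * Y) (1 - Y ^+ 2)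
  = steinberg (1 - X) (1 - Y) *+ 2 + steinberg (1 - X ^+ 2) (1 - Y ^+ 2).
Proof.
move=> fX fY oX oY oXY oX2 oY2.
have eX : 1 - X ^+ 2 = (1 - X) * (1 + X) by ring.
have eY : 1 - Y ^+ 2 = (1 - Y) * (1 + Y) by ring.
rewrite eX in oX2 *; rewrite eY in oY2 *.
have om := orthMKl oX oX2; have ok := orthMKl oY oY2.
have h1 := cyclo_triangle fX oX oY oXY.
have h2 : steinberg (1 + X) (1 + Y)
    = steinberg (1 + X) (1 - X * Y) + steinberg (1 - X * Y) (1 + Y).
  by apply: (steinberg3 flat1 (flatN fX)) => //; ring.
move: oX oY oXY om ok h1 h2 {oX2 oY2 eX eY}.
move: (1 - X) (1 - Y) (1 - X * Y) (1 + X) (1 + Y) => a b c m k.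
move=> [ua _] [ub _] [uc _] [um _] [uk _] h1 h2.
rewrite !steinbergMl ?unitrM ?ua ?ub ?um ?uk // !steinbergMr //.
by apply: (eq_add_hyp (esym h1)); apply: (eq_add_hyp (esym h2)); zmod.
Qed.

                                                                       
                                                                            
                                                                               
                  
(** The analogue for T_3. Seven linear relations [h1] to [h7] between 1 - X, 1 - Y, 1 - X Y, 1 - X^2
    Y, 1 - X Y^2 and the quadratic cofactors of 1 - X^3, 1 - Y^3, 1 - (X Y)^3 add up to the claim,
    with suitable signs. *)
Lemma cyclo_hecke3 X Y : flat X -> flat Y ->
  orth (1 - X) -> orth (1 - Y) -> orth (1 - X * Y) ->
  orth (1 - X ^+ 2 * Y) -> orth (1 - X * Y ^+ 2) ->
  orth (1 - X ^+ 3) -> orth (1 - Y ^+ 3) -> orth (1 - (X * Y) ^+ 3) ->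
  steinberg (1 - X) (1 - Y ^+ 3) + steinberg (1 - X * Y) (1 - Y ^+ 3)
  + steinberg (1 - X * Y ^+ 2) (1 - Y ^+ 3) + steinberg (1 - X ^+ 3) (1 - Y)
  + steinberg (1 - X ^+ 3) (1 - X * Y) + steinberg (1 - X ^+ 3) (1 - X ^+ 2 * Y)
  + steinberg (1 - X ^+ 2 * Y) (1 - X * Y ^+ 2)
  = steinberg (1 - X) (1 - Y) *+ 3 + steinberg (1 - X ^+ 3) (1 - Y ^+ 3).
Proof.
move=> fX fY oa ob oc os ot oX3 oY3 oXY3.
have eX : 1 - X ^+ 3 = (1 - X) * (1 + X + X ^+ 2) by ring.
have eY : 1 - Y ^+ 3 = (1 - Y) * (1 + Y + Y ^+ 2) by ring.
have eXY : 1 - (X * Y) ^+ 3 = (1 - X * Y) * (1 + X * Y + (X * Y) ^+ 2) by ring.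
have oA : orth (1 + X + X ^+ 2) by apply: (orthMKl oa); rewrite -eX.
have oB : orth (1 + Y + Y ^+ 2) by apply: (orthMKl ob); rewrite -eY.
have oC : orth (1 + X * Y + (X * Y) ^+ 2) by apply: (orthMKl oc); rewrite -eXY.
have h1 := cyclo_triangle fX oa ob oc.
have h2 : steinberg (1 - X) (1 - X * Y) = steinberg (1 - X) (1 - X ^+ 2 * Y)
    + steinberg (1 - X ^+ 2 * Y) (1 - X * Y).
  by apply: (steinberg3 flat1 fX) => //; ring.
have h3 : steinberg (1 - Y) (1 - X * Y) = steinberg (1 - Y) (1 - X * Y ^+ 2)
    + steinberg (1 - X * Y ^+ 2) (1 - X * Y).
  by apply: (steinberg3 flat1 fY) => //; ring.
(* The underlying identity is (1 + X Y + X^2 Y^2) - Y (1 + X + X^2) = (1 - X^2 Y)(1 - Y); [h5] is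
   its mirror image. *)
have h4 := steinberg3 flat1 (flatN fY) oC oA (orthM os ob) ltac:(ring).
have h5 := steinberg3 flat1 (flatN fX) oC oB (orthM ot oa) ltac:(ring).
have h6 : steinberg (1 - X ^+ 3) (1 - Y ^+ 3) =
    steinberg (1 - X ^+ 3) (1 - (X * Y) ^+ 3)
    + steinberg (1 - (X * Y) ^+ 3) (1 - Y ^+ 3).
  by apply: (steinberg3 flat1 (flatX 3 fX)) => //; ring.
have h7 := steinberg3 flat1 (flatM (flatX 2 fX) fY) os ot oXY3 ltac:(ring).
rewrite {}eX {}eY {}eXY in h6 h7 *.
move: oa ob oc os ot oA oB oC h1 h2 h3 h4 h5 h6 h7 {oX3 oY3 oXY3}.
move: (1 - X) (1 - Y) (1 - X * Y) (1 - X ^+ 2 * Y) (1 - X * Y ^+ 2).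
move: (1 + X + _) (1 + Y + _) (1 + X * Y + _) => A' B C a b c s t.
move=> [ua _] [ub _] [uc _] [us _] [ut _] [uA _] [uB _] [uC _].
have uM u v : unit u -> unit v -> unit (u * v) by move=> uu uv; rewrite unitrM uu.
have SMl u v w := @steinbergMl u v w; have SMr u v w := @steinbergMr u v w.
have anti u v := @steinbergC u v.
rewrite !SMl ?SMr ?SMl; auto.
(* Orients every symbol the same way, so that {u, v} and {v, u} do not count as independent
   variables for [zmod]. *)
rewrite (anti C A') ?(anti C B) ?(anti C s) ?(anti C t) ?(anti C a) ?(anti C b) //.
rewrite (anti b c) ?(anti c t) ?(anti t b) ?(anti A' s) ?(anti A' b) //.
move=> h1 h2 h3 h4 h5 h6 h7.
apply: (eq_add_hyp (esym h1)); apply: (eq_add_hyp (esym h2)).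
apply: (eq_add_hyp h3); apply: (eq_add_hyp h4); apply: (eq_add_hyp (esym h5)).
by apply: (eq_add_hyp (esym h6)); apply: (eq_add_hyp h7); zmod.
Qed.

                                                                                 
                                                                             
(** Replaces [cyclo_hecke3] when Y = X^-2, where 1 - X^2 Y vanishes. The two inputs are (1 + X +
    X^2) - X (1 + X) = 1 and X (1 - X) + (1 - X + X^2) = 1. *)
Lemma cyclo_hecke3_diag X : flat X ->
  orth (1 - X) -> orth (1 - X ^+ 2) -> orth (1 - X ^+ 3) -> orth (1 - X ^+ 6) ->
  steinberg (1 - X) (1 - X ^+ 6) *+ 2 + steinberg (1 - X ^+ 3) (1 - X ^+ 2)
  + steinberg (1 - X ^+ 3) (1 - X) = steinberg (1 - X) (1 - X ^+ 2) *+ 3.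
Proof.
move=> fX oa o2 o3 o6.
have e2 : 1 - X ^+ 2 = (1 - X) * (1 + X) by ring.
have e3 : 1 - X ^+ 3 = (1 - X) * (1 + X + X ^+ 2) by ring.
have e6 : 1 - X ^+ 6 = (1 - X ^+ 3) * ((1 + X) * (1 - X + X ^+ 2)) by ring.
have om : orth (1 + X) by apply: (orthMKl oa); rewrite -e2.
have oA : orth (1 + X + X ^+ 2) by apply: (orthMKl oa); rewrite -e3.
have oP : orth (1 - X + X ^+ 2).
  by apply: (orthMKl om); apply: (orthMKl o3); rewrite -e6.
have hA : steinberg (1 + X + X ^+ 2) (1 + X) = 0.
  by apply: (steinberg3_1 flat1 (flatN fX)) => //; ring.
have hP : steinberg (1 - X) (1 - X + X ^+ 2) = 0.
  by apply: (steinberg3_1 fX flat1) => //; ring.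
rewrite {}e6 {}e3 {}e2; move: oa om oA oP hA hP {o2 o3 o6}.
move: (1 - X) (1 + X) (1 + X + _) (1 - X + _) => a m B P.
move=> [ua _] [um _] [uB _] [uP _] hA hP.
have uM u v : unit u -> unit v -> unit (u * v) by move=> uu uv; rewrite unitrM uu.
have SMl u v w := @steinbergMl u v w; have SMr u v w := @steinbergMr u v w.
rewrite !SMl ?SMr ?SMl; auto; rewrite hA hP steinbergrr // (steinbergC uB ua).
zmod.
Qed.

End SteinbergSymbols.

                               

(** * Additive maps on free abelian groups, and functoriality of [K2t] *)

Lemma freeg_ext (K : choiceType) (V : zmodType)
    (f g : {additive {freeg K / int} -> V}) :
  (forall x, f (freeg_gen x) = g (freeg_gen x)) -> f =1 g.
Proof.
move=> eq_fg D; elim/freeg_ind_dom0: D => [|k x D _ _ IHD]; first by rewrite !raddf0.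
rewrite !raddfD /= IHD; congr (_ + _).
have -> : << k *g x >> = freeg_gen x *~ k.
  by rewrite /freeg_gen freeg_mulz intz.
by rewrite !raddfMz /= eq_fg.
Qed.

Lemma K2t_mapD (A B : comUnitRingType) (f : {rmorphism A -> B}) :
  {morph K2t_map f : x y / x + y}.
Proof.
by elim/quotW=> x; elim/quotW=> y; rewrite -raddfD !K2t_mapE K2M_mapD raddfD.
Qed.

Lemma freeg_map_comp (K K' K'' : choiceType) (f : K' -> K'') (g : K -> K') :
  freeg_map (f \o g) =1 freeg_map f \o freeg_map g.
Proof.
pose fg : {additive {freeg K / int} -> {freeg K'' / int}} :=
  (freeg_map f \o freeg_map g)%FUN.
by apply: (@freeg_ext _ _ (freeg_map _) fg) => x; rewrite /= !freeg_map_gen.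
Qed.

Lemma eq_freeg_map (K K' : choiceType) (f g : K -> K') :
  f =1 g -> freeg_map f =1 freeg_map g.
Proof.
move=> fg; apply: (@freeg_ext _ _ (freeg_map _) (freeg_map _)) => x /=.
by rewrite !freeg_map_gen fg.
Qed.

Lemma K2t_map_id (A : comUnitRingType) (f : {rmorphism A -> A}) :
  f =1 id -> K2t_map f =1 id.
Proof.
move=> f1; elim/quotW=> x; elim/quotW: x => D; rewrite K2t_mapE K2M_mapE.
congr (\pi_(K2t A) (\pi_(K2M A) _)).
apply: (@freeg_ext _ _ (freeg_map _) idfun) => -[u v] /=; rewrite freeg_map_gen.
by congr (freeg_gen (_, _)); apply: val_inj; rewrite /= f1.
Qed.

Lemma K2t_map_comp (A B C : comUnitRingType) (f : {rmorphism B -> C})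
    (g : {rmorphism A -> B}) (h : {rmorphism A -> C}) :
  h =1 f \o g -> K2t_map h =1 K2t_map f \o K2t_map g.
Proof.
move=> hfg; elim/quotW=> x; elim/quotW: x => D; rewrite /= [K2t_map g _]K2t_mapE !K2t_mapE.
rewrite [K2M_map g _]K2M_mapE !K2M_mapE.
congr (\pi_(K2t C) (\pi_(K2M C) _)).
rewrite -[RHS]freeg_map_comp.
by apply: eq_freeg_map => -[u v] /=; congr pair; apply: val_inj; rewrite /= hfg.
Qed.

                            

(** * The elements 1 - zeta^x as units orthogonal to zeta *)

(** Divide the factorisation of X^N - 1 by X - 1 and evaluate at 1. *)
Lemma prod_1subX (F : fieldType) (N : nat) (z : F) : N.-primitive_root z ->
  \prod_(1 <= i < N) (1 - z ^+ i) = N%:R.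
Proof.
move=> hz; have N0 := prim_order_gt0 hz.
have := factor_Xn_sub_1 hz; rewrite big_ltn // expr0 subrX1 => /mulfI.
move=> /(_ (negbT (polyXsubC_eq0 _))) /(congr1 (horner^~ 1)).
rewrite horner_prod horner_sum => h.
transitivity (\prod_(1 <= i < N) ('X - (z ^+ i)%:P).[1]).
  by apply: eq_bigr => i _; rewrite !hornerE.
rewrite {}h (eq_bigr (fun=> 1)) => [|i _]; last by rewrite !hornerE expr1n.
by rewrite sumr_const card_ord.
Qed.

(** For y nonzero, evaluate the factorisation of X^m - 1 at 1/y and multiply by y^m. *)
Lemma prod_1subMX (F : fieldType) (m : nat) (w y : F) : m.-primitive_root w ->
  \prod_(0 <= j < m) (1 - y * w ^+ j) = 1 - y ^+ m.
Proof.
move=> hw; have m0 := prim_order_gt0 hw.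
have [->|y0] := eqVneq y 0.
  by rewrite expr0n gtn_eqF // subr0 big1 // => j _; rewrite mul0r subr0.
have /(congr1 (horner^~ y^-1)) := factor_Xn_sub_1 hw.
rewrite horner_prod !hornerE => h.
transitivity (y ^+ m * \prod_(0 <= j < m) ('X - (w ^+ j)%:P).[y^-1]).
  rewrite -[in y ^+ m](subn0 m) -prodr_const_nat -big_split; apply: eq_bigr => j _.
  by rewrite /= hornerXsubC mulrBr divff.
by rewrite {}h mulrBr mulr1 -exprMn divff // expr1n.
Qed.

Lemma natf_ext_neq0 (L : fieldExtType rat) (k : nat) : (0 < k)%N -> k%:R != 0 :> L.
Proof.
move=> k0; have -> : k%:R = k%:R%:A :> L by rewrite scaler_nat.
by rewrite scaler_eq0 oner_eq0 orbF pnatr_eq0 -lt0n.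
Qed.

Section CycloRing.

Context (p n : nat) (hp : prime p) (hn : (1 <= n)%N).
Context (L : splittingFieldType rat) (z : L) (hz : (p ^ n).-primitive_root z).

Local Notation N := (p ^ n)%N.
Local Notation R := (Rn p z).
Local Notation zeta := (zetaR p z).

Let N_gt1 : (1 < N)%N. Proof. by rewrite -(exp1n n) ltn_exp2r // prime_gt1. Qed.

Lemma Rn_valM (x y : R) : Rn_val (x * y) = Rn_val x * Rn_val y.
Proof. by []. Qed.

Lemma Rn_val1 : Rn_val (1 : R) = 1. Proof. by []. Qed.

Lemma Rn_valX (x : R) k : Rn_val (x ^+ k) = Rn_val x ^+ k.
Proof. by elim: k => [|k IHk]; rewrite ?expr0 // !exprS Rn_valM IHk. Qed.

Lemma Rn_val_nat k : Rn_val (k%:R : R) = k%:R.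
Proof. by elim: k => // k IHk; rewrite -!natr1 -IHk. Qed.

Lemma Rn_val_prod (I : Type) (r : seq I) (P : pred I) (F : I -> R) :
  Rn_val (\prod_(i <- r | P i) F i) = \prod_(i <- r | P i) Rn_val (F i).
Proof. by apply: (big_morph (@Rn_val L p z) Rn_valM Rn_val1). Qed.

Lemma zetaXN : zeta ^+ N = 1.
Proof. by apply: val_inj; rewrite /= Rn_valX (prim_expr_order hz). Qed.

Lemma zeta_unit : zeta \is a GRing.unit.
Proof.
by apply/unitrP; exists (zeta ^+ N.-1); rewrite -exprS -exprSr prednK ?zetaXN // ltnW.
Qed.

Lemma pinv_Rn : p%:R^-1 \in Rn_pred p z.
Proof. exact/asboolP/RnPV. Qed.

Lemma zeta1_unit (x : nat) : ~~ (N %| x)%N -> 1 - zeta ^+ x \is a GRing.unit.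
Proof.
move=> Nx; have lt_r : (x %% N < N)%N by rewrite ltn_mod ltnW.
rewrite -(expr_mod _ zetaXN); move: lt_r Nx; rewrite /dvdn.
move: (x %% N)%N => r lt_r r0.
(* The product of all 1 - zeta^i with 0 < i < N is p^n, so the remaining factors divided by p^n form
   the inverse. *)
pose w := \prod_(1 <= i < N | i != r) (1 - zeta ^+ i) * (MkRn pinv_Rn) ^+ n.
have w1 : w * (1 - zeta ^+ r) = 1.
  apply: val_inj; rewrite /= !Rn_valX Rn_val_prod /= mulrAC.
  rewrite (eq_bigr (fun i => 1 - z ^+ i)) => [|i _]; last by rewrite /= Rn_valX.
  have := prod_1subX hz; rewrite (bigD1_seq r) ?iota_uniq //=; last first.
    by rewrite mem_index_iota lt0n r0.
  by rewrite mulrC => ->; rewrite natrX -exprMn divff ?expr1n // natf_ext_neq0 // prime_gt0.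
by apply/unitrP; exists w; split; rewrite // mulrC.
Qed.

Local Notation orth := (orth zeta).
Local Notation flat := (flat zeta).

(** The symbol is killed by p^n because zeta^(p^n) = 1, and by x because {zeta^x, 1 - zeta^x} = 0;
    these integers are coprime. *)
Lemma orth_zeta1_coprime (x : nat) : coprime x p -> orth (1 - zeta ^+ x).
Proof.
move=> co_xp; have co_xN : coprime x N by rewrite coprimeXr.
have Nx : ~~ (N %| x)%N.
  apply/negP => /gcdn_idPr; rewrite (eqP co_xN) => N1.
  by move: N_gt1; rewrite -N1.
have ux := zeta1_unit Nx; split=> //; set s := steinberg _ _.
have sN : s *+ N = 0.
  by rewrite /s -steinbergXl ?zeta_unit // zetaXN steinberg1l.
have sx : s *+ x = 0.
  rewrite /s -steinbergXl ?zeta_unit // steinberg_add1 ?unitrX ?zeta_unit //.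
  by rewrite addrC subrK.
have [|u v euv _] := @egcdnP x N.
  by case: (x) co_xN => //; rewrite /coprime gcd0n => /eqP N1; move: N_gt1; rewrite N1.
move: euv; rewrite (eqP co_xN) => euv.
have : s *+ (u * x) = 0 by rewrite mulnC mulrnA sx mul0rn.
by rewrite euv addn1 mulrSr mulnC mulrnA sN mul0rn add0r.
Qed.

(** Write x = u m with m = p^k the p-part of x. Then 1 - zeta^x is the product of the 1 - zeta^u w^j
    over the m-th roots of unity w^j, w = zeta^(N/m), which reduces to exponents prime to p. *)
Lemma orth_zeta1 (x : nat) : ~~ (N %| x)%N -> orth (1 - zeta ^+ x).
Proof.
move=> Nx; have x0 : (0 < x)%N by case: x Nx; rewrite ?dvdn0.
pose k := logn p x; pose u := (x`_p^')%N; pose m := (p ^ k)%N.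
have ex : x = (u * m)%N by rewrite mulnC -{1}(partnC p x0) p_part.
have lt_kn : (k < n)%N.
  by rewrite ltnNge; apply: contra Nx => le_nk; rewrite ex dvdn_mull // dvdn_exp2l.
have m_dvd : (m %| N)%N by rewrite dvdn_exp2l // ltnW.
have hw : m.-primitive_root (z ^+ (N %/ m)) := dvdn_prim_root hz m_dvd.
have -> : 1 - zeta ^+ x = \prod_(0 <= j < m) (1 - zeta ^+ (u + N %/ m * j)).
  apply: val_inj; rewrite /= Rn_valX Rn_val_prod /= ex exprM.
  rewrite -(prod_1subMX (z ^+ u) hw); apply: eq_bigr => j _.
  by rewrite /= Rn_valX exprD exprM.
rewrite big_seq; apply: (big_ind orth) => [||j _]; [exact: orth1 zeta_unit|exact: orthM zeta_unit|].
(* As k < n, p divides N/m = p^(n-k), so the exponent is congruent to u modulo p. *)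
apply: orth_zeta1_coprime; rewrite coprime_sym prime_coprime // dvdn_addl.
  by rewrite -p'natE // part_pnat.
by rewrite dvdn_mulr // /m -expnB ?prime_gt0 ?(ltnW lt_kn) // dvdn_exp ?subn_gt0.
Qed.

Definition zexp (x : 'Z_N) : R := zeta ^+ x.

Lemma zexpD x y : zexp (x + y) = zexp x * zexp y.
Proof.
rewrite /zexp /= -exprD -[RHS](expr_mod _ zetaXN).
by congr (_ ^+ (_ %% _)%N); apply: Zp_cast.
Qed.

Lemma zexp0 : zexp 0 = 1. Proof. by []. Qed.

Lemma zexpN x : zexp (- x) * zexp x = 1.
Proof. by rewrite -zexpD addNr zexp0. Qed.

Lemma zexpMn x k : zexp (x *+ k) = zexp x ^+ k.
Proof. by elim: k => [|k IHk]; rewrite ?mulr0n // mulrS exprS zexpD IHk. Qed.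

Lemma flat_zexp x : flat (zexp x).
Proof. exact: flatX (flatz zeta_unit). Qed.

Lemma orth_zexp x : x != 0 -> orth (1 - zexp x).
Proof.
move=> x0; apply: orth_zeta1; rewrite /dvdn modn_small.
  by rewrite -val_eqE in x0.
by have := ltn_ord x; rewrite [X in (_ < X)%N -> _](Zp_cast N_gt1).
Qed.

End CycloRing.

                          

(** * Conjugates of a primitive root of unity *)

(** Some factor of X^N - 1, indexed by a divisor d of N, vanishes at w; then w^d = 1 forces d =
    N. *)
Lemma root_map_Cyclotomic (F : fieldType) (N : nat) (w : F) :
  N.-primitive_root w -> root (map_poly intr 'Phi_N) w.
Proof.
move=> hw; have N0 := prim_order_gt0 hw.
have mapXn1 d : map_poly intr ('X^d - 1) = 'X^d - 1 :> {poly F}.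
  by rewrite rmorphB /= map_polyXn rmorph1.
have : root (map_poly intr (\prod_(d <- divisors N) 'Phi_d)) w.
  by rewrite prod_Cyclotomic // mapXn1 rootE !hornerE (prim_expr_order hw) subrr.
rewrite rmorph_prod rootE horner_prod prodf_seq_eq0 => /hasP[d /=].
rewrite -dvdn_divisors // => d_dvd /eqP wd.
have d0 : (0 < d)%N := dvdn_gt0 N0 d_dvd.
suff -> : N = d by rewrite rootE wd.
apply/eqP; rewrite eqn_dvd d_dvd andbT (prim_order_dvd hw).
have : root (map_poly intr (\prod_(e <- divisors d) 'Phi_e)) w.
  rewrite (big_rem d) /=; last by rewrite -dvdn_divisors.
  by rewrite rmorphM rootE hornerM wd mul0r.
by rewrite prod_Cyclotomic // mapXn1 rootE !hornerE subr_eq0.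
Qed.

(** Irreducibility of the cyclotomic polynomial, carried over from [algC]: the minimal polynomial m
    of z over Q divides Phi_N, and a root of m in [algC] is a primitive N-th root of unity with
    minimal polynomial Phi_N, so Phi_N divides m. *)
Lemma root_minPoly_prim_root (L : fieldExtType rat) (N k : nat) (z : L) :
  N.-primitive_root z -> coprime k N -> root (minPoly 1 z) (z ^+ k).
Proof.
move=> hz co_kN; have N0 := prim_order_gt0 hz.
have /polyOver1P[m em] := minPolyOver 1 z.
have ZtoL : map_poly (in_alg L) (map_poly intr 'Phi_N) = map_poly intr 'Phi_N.
  by rewrite -map_poly_comp; apply: eq_map_poly => a; rewrite /= scaler_int.
have ZtoC : map_poly (ratr : rat -> algC) (map_poly intr 'Phi_N) = map_poly intr 'Phi_N.
  by rewrite -map_poly_comp; apply: eq_map_poly => a; rewrite /= rmorph_int.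
have m_dvd : m %| map_poly intr 'Phi_N.
  rewrite -(dvdp_map (in_alg L)) -em ZtoL minPoly_dvdp ?root_map_Cyclotomic //.
  by rewrite -ZtoL; apply/polyOver1P; exists (map_poly intr 'Phi_N).
suff Phi_dvd : map_poly intr 'Phi_N %| m.
  rewrite em; apply: (@root_dvdp _ (map_poly (in_alg L) (map_poly intr 'Phi_N))).
    by rewrite dvdp_map.
  by rewrite ZtoL root_map_Cyclotomic // prim_root_exp_coprime.
have /closed_rootP[w mw] : size (map_poly (ratr : rat -> algC) m) != 1%N.
  rewrite size_map_poly -(size_map_poly (in_alg L)) -em size_minPoly.
  by rewrite eqSS.
have [w0 hw0] := C_prim_root_exists N0.
have hw : N.-primitive_root w.
  rewrite -(root_cyclotomic hw0) -(Cintr_Cyclotomic hw0) -ZtoC.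
  by apply: root_dvdp mw; rewrite dvdp_map.
have [f [ef _] dvd_f] := minCpolyP w.
have -> : map_poly intr 'Phi_N = f.
  apply: (map_poly_inj (ratr : {rmorphism rat -> algC})).
  by rewrite /= ZtoC -ef (minCpoly_cyclotomic hw) (Cintr_Cyclotomic hw).
by rewrite -dvd_f.
Qed.

(** * Galois action, and the cyclotomic Manin symbol *)

Section GaloisAction.

Context (p n : nat) (hp : prime p) (hn : (1 <= n)%N).
Context (L : splittingFieldType rat) (z : L) (hz : (p ^ n).-primitive_root z).

Local Notation N := (p ^ n)%N.
Local Notation R := (Rn p z).

Let N_gt1 : (1 < N)%N. Proof. by rewrite -(exp1n n) ltn_exp2r // prime_gt1. Qed.

Lemma unit_ZpE (l : 'Z_N) : (l \is a GRing.unit) = coprime l N.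
Proof. by rewrite -{1}[l]natr_Zp unitZpE // coprime_sym. Qed.

(** By normality an automorphism sending z to its conjugate z^l exists, so the default value in
    [sigma] is avoided. *)
Lemma sigmaE (l : 'Z_N) : l \is a GRing.unit -> sigma z l z = z ^+ l.
Proof.
rewrite unit_ZpE => /(root_minPoly_prim_root hz) hroot.
have [g gG gz] := normalField_root_minPoly (sub1v _) (normalFieldf 1) (memvf z) hroot.
rewrite /sigma; case: pickP => [h /andP[_ /eqP //]|/(_ g)].
by rewrite gG gz eqxx.
Qed.

Lemma galR_zetaR (g : gal_of {:L}) k :
  g z = z ^+ k -> galR hz g (zetaR p z) = zetaR p z ^+ k.
Proof. by move=> gz; apply: val_inj; rewrite /= Rn_valX. Qed.

(** The ring is generated by zeta and 1/p, and a morphism has no choice on 1/p. This yields the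
    composition law of [sigmaK2] from its values at zeta. *)
Lemma galR_ext (f g : {rmorphism R -> R}) :
  f (zetaR p z) = g (zetaR p z) -> f =1 g.
Proof.
move=> fg x; have hx : in_Rn p z (Rn_val x) by case: x => x /= /asboolP.
suff H v : in_Rn p z v -> forall y, Rn_val y = v -> f y = g y.
  exact: H hx x (erefl _).
elim=> {v} [|||v w hv IHv hw IHw|v w hv IHv hw IHw] y ey.
- by have -> : y = zetaR p z by apply: val_inj.
- have yp : y * p%:R = 1.
    by apply: val_inj; rewrite /= Rn_val_nat ey mulVf // natf_ext_neq0 // prime_gt0.
  have up : (p%:R : R) \is a GRing.unit by apply/unitrP; exists y; split; rewrite // mulrC.
  apply: (mulIr up).
  by rewrite -[in LHS](rmorph_nat f) -[in RHS](rmorph_nat g) -!rmorphM yp !rmorph1.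
- by have -> : y = 1 by [apply: val_inj]; rewrite !rmorph1.
- have -> : y = MkRn (introT (asboolP _) hv) - MkRn (introT (asboolP _) hw).
    exact: val_inj.
  by rewrite !rmorphB IHv ?IHw.
- have -> : y = MkRn (introT (asboolP _) hv) * MkRn (introT (asboolP _) hw).
    exact: val_inj.
  by rewrite !rmorphM IHv ?IHw.
Qed.

Lemma sigmaK2D (l : 'Z_N) : {morph sigmaK2 (p := p) hz l : x y / x + y}.
Proof. exact: K2t_mapD. Qed.

Lemma sigmaK2_1 : sigmaK2 (p := p) hz 1 =1 id.
Proof.
apply: K2t_map_id; apply: (galR_ext (g := idfun)).
rewrite /= (galR_zetaR (k := 1)) //; have := sigmaE (unitr1 _).
by rewrite /= Zp_cast // modn_small.
Qed.

Lemma sigmaK2M (l m : 'Z_N) : l \is a GRing.unit -> m \is a GRing.unit ->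
  sigmaK2 (p := p) hz (l * m) =1 sigmaK2 hz l \o sigmaK2 hz m.
Proof.
move=> ul um; apply: K2t_map_comp.
apply: (galR_ext (g := galR hz (sigma z l) \o galR hz (sigma z m))) => /=.
rewrite !(galR_zetaR (sigmaE _)) ?unitrM ?ul //.
rewrite rmorphXn /= (galR_zetaR (sigmaE _)) //= -exprM.
rewrite -[RHS](expr_mod _ (zetaXN hz)).
by congr (_ ^+ (_ %% _)%N); apply: Zp_cast.
Qed.

Local Notation zexp := (@zexp p n L z).

Lemma cyclo_symbolE (x y : 'Z_N) : x != 0 -> y != 0 ->
  cyclo_symbol p z N x y = steinberg (1 - zexp x) (1 - zexp y).
Proof. by move=> x0 y0; rewrite /cyclo_symbol x0 y0. Qed.

Lemma cyclo_symbol0l (y : 'Z_N) : cyclo_symbol p z N 0 y = 0.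
Proof. by rewrite /cyclo_symbol eqxx. Qed.

Lemma cyclo_symbol0r (x : 'Z_N) : cyclo_symbol p z N x 0 = 0.
Proof. by rewrite /cyclo_symbol eqxx andbF. Qed.

Lemma cyclo_symbolM (l x y : 'Z_N) : l \is a GRing.unit ->
  cyclo_symbol p z N (l * x) (l * y) = sigmaK2 hz l (cyclo_symbol p z N x y).
Proof.
move=> ul; have sl0 : sigmaK2 (p := p) hz l 0 = 0.
  by apply: (addrI (sigmaK2 (p := p) hz l 0)); rewrite -sigmaK2D !addr0.
have lM0 w : (l * w == 0) = (w == 0).
  by apply/eqP/eqP => [lw|->]; [apply: (mulrI ul) |]; rewrite ?mulr0.
have [->|x0] := eqVneq x 0; first by rewrite mulr0 !cyclo_symbol0l.
have [->|y0] := eqVneq y 0; first by rewrite mulr0 !cyclo_symbol0r.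
rewrite !cyclo_symbolE ?lM0 // /sigmaK2 K2t_map_steinberg; first last.
- by case: (orth_zexp hp hn hz y0).
- by case: (orth_zexp hp hn hz x0).
have zl w : zexp (l * w) = galR hz (sigma z l) (zexp w).
  rewrite /zexp rmorphXn /= (galR_zetaR (sigmaE _)) // -exprM.
  rewrite -[RHS](expr_mod _ (zetaXN hz)).
  by congr (_ ^+ (_ %% _)%N); apply: Zp_cast.
by rewrite !rmorphB /= !rmorph1 -!zl.
Qed.

Lemma cyclo_symbolC (x y : 'Z_N) :
  cyclo_symbol p z N x y = - cyclo_symbol p z N y x.
Proof.
have [->|x0] := eqVneq x 0; first by rewrite cyclo_symbol0l cyclo_symbol0r oppr0.
have [->|y0] := eqVneq y 0; first by rewrite cyclo_symbol0l cyclo_symbol0r oppr0.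
have [[ux _] [uy _]] := (orth_zexp hp hn hz x0, orth_zexp hp hn hz y0).
by rewrite !cyclo_symbolE // steinbergC.
Qed.

(** 1 - zeta^(-y) is 1 - zeta^y times the flat factor -zeta^(-y). *)
Lemma cyclo_symbolNr (x y : 'Z_N) :
  cyclo_symbol p z N x (- y) = cyclo_symbol p z N x y.
Proof.
have [->|x0] := eqVneq x 0; first by rewrite !cyclo_symbol0l.
have [->|y0] := eqVneq y 0; first by rewrite oppr0.
have [ox oy] := (orth_zexp hp hn hz x0, orth_zexp hp hn hz y0).
rewrite !cyclo_symbolE ?oppr_eq0 //.
have -> : 1 - zexp (- y) = - zexp (- y) * (1 - zexp y).
  by rewrite mulrBr mulNr mulr1 mulNr (zexpN hp hn hz) opprK addrC.
rewrite (@steinberg_flatMr _ (zetaR p z)) //.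
by apply: flatN; exact: flat_zexp.
Qed.

Lemma cyclo_symbolNl (x y : 'Z_N) :
  cyclo_symbol p z N (- x) y = cyclo_symbol p z N x y.
Proof. by rewrite cyclo_symbolC cyclo_symbolNr -cyclo_symbolC. Qed.

Lemma cyclo_symbolxx (x : 'Z_N) : cyclo_symbol p z N x x = 0.
Proof.
have [->|x0] := eqVneq x 0; first by rewrite !cyclo_symbol0l.
have [ux _] := orth_zexp hp hn hz x0.
by rewrite cyclo_symbolE // steinbergrr.
Qed.

Lemma cyclo_symbol_manin : is_manin p n (sigmaK2 hz) (cyclo_symbol p z N).
Proof.
move=> x y _; split=> [l||]; first exact: cyclo_symbolM.
  by rewrite cyclo_symbolNr [X in _ + X]cyclo_symbolC subrr.
rewrite -opprD cyclo_symbolNr cyclo_symbolNl.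
have [->|x0] := eqVneq x 0.
  by rewrite cyclo_symbol0l cyclo_symbol0r !add0r addr0 cyclo_symbolxx.
have [->|y0] := eqVneq y 0.
  by rewrite cyclo_symbol0l cyclo_symbol0r !add0r addr0 cyclo_symbolxx.
(* Where x + y = 0 the symbol is 0 by convention and 1 - zeta^(x + y) is not a unit, so
   [cyclo_triangle] does not apply; antisymmetry and parity suffice. *)
have [xy0|xy0] := eqVneq (x + y) 0.
  have -> : y = - x by apply/eqP; rewrite -addr_eq0 addrC xy0.
  rewrite cyclo_symbolNr cyclo_symbolxx subrr.
  by rewrite cyclo_symbol0l cyclo_symbol0r !addr0.
have oxy := orth_zexp hp hn hz xy0; rewrite (zexpD hp hn hz) in oxy.
have := cyclo_triangle (zeta_unit hp hn hz) (flat_zexp hp hn hz x)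
  (orth_zexp hp hn hz x0) (orth_zexp hp hn hz y0) oxy.
rewrite -(zexpD hp hn hz) -!cyclo_symbolE // => ->.
rewrite (cyclo_symbolC y) (cyclo_symbolC (x + y) x).
by move: (cyclo_symbol p z N x _) (cyclo_symbol p z N _ y) => a b; zmod.
Qed.

Lemma Zp_mulrn_neq0 (q : nat) (x : 'Z_N) : prime q -> q != p -> x != 0 -> x *+ q != 0.
Proof.
move=> hq qp; apply: contra => /eqP xq.
have uq : (q%:R : 'Z_N) \is a GRing.unit.
  by rewrite unitZpE // coprime_sym coprimeXr // prime_coprime // dvdn_prime2.
by apply/eqP/(mulIr uq); rewrite mul0r mulr_natr.
Qed.

Lemma cyclo_symbol_hecke2 (x y : 'Z_N) : (2%N != p) -> x != 0 -> y != 0 ->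
  cyclo_symbol p z N x (y *+ 2) + cyclo_symbol p z N (x *+ 2) y
  + cyclo_symbol p z N (x *+ 2) (x + y) + cyclo_symbol p z N (x + y) (y *+ 2)
  = cyclo_symbol p z N x y *+ 2 + cyclo_symbol p z N (x *+ 2) (y *+ 2).
Proof.
move=> p2 x0 y0; have x20 := Zp_mulrn_neq0 (q := 2) isT p2 x0.
have y20 := Zp_mulrn_neq0 (q := 2) isT p2 y0.
have [xy0|xy0] := eqVneq (x + y) 0.
  have -> : y = - x by apply/eqP; rewrite -addr_eq0 addrC xy0.
  rewrite subrr cyclo_symbol0l cyclo_symbol0r mulNrn !cyclo_symbolNr !cyclo_symbolxx.
  rewrite (cyclo_symbolC (x *+ 2) x).
  by move: (cyclo_symbol p z N x _) => a; zmod.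
have o w := @orth_zexp p n hp hn L z hz w.
have := cyclo_hecke2 (zeta_unit hp hn hz) (flat_zexp hp hn hz x)
  (flat_zexp hp hn hz y) (o _ x0) (o _ y0).
rewrite -(zexpD hp hn hz) -!(zexpMn hp hn hz).
by move=> /(_ (o _ xy0) (o _ x20) (o _ y20)); rewrite -!cyclo_symbolE.
Qed.

Lemma cyclo_symbol_hecke3_diag (x : 'Z_N) : (3%N != p) -> x != 0 -> x *+ 2 != 0 ->
  cyclo_symbol p z N x (x *+ 6) *+ 2 + cyclo_symbol p z N (x *+ 3) (x *+ 2)
  + cyclo_symbol p z N (x *+ 3) x = cyclo_symbol p z N x (x *+ 2) *+ 3.
Proof.
move=> p3 x0 x20; have x30 := Zp_mulrn_neq0 (q := 3) isT p3 x0.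
have x60 : x *+ 6 != 0 by rewrite (mulrnA x 2 3) Zp_mulrn_neq0.
have o w := @orth_zexp p n hp hn L z hz w.
have := cyclo_hecke3_diag (zeta_unit hp hn hz) (flat_zexp hp hn hz x) (o _ x0).
rewrite -!(zexpMn hp hn hz) => /(_ (o _ x20) (o _ x30) (o _ x60)).
by rewrite -!cyclo_symbolE.
Qed.

Lemma cyclo_symbol_hecke3 (x y : 'Z_N) : (3%N != p) -> x != 0 -> y != 0 ->
  cyclo_symbol p z N x (y *+ 3) + cyclo_symbol p z N (x + y) (y *+ 3)
  + cyclo_symbol p z N (x + y *+ 2) (y *+ 3) + cyclo_symbol p z N (x *+ 3) y
  + cyclo_symbol p z N (x *+ 3) (x + y) + cyclo_symbol p z N (x *+ 3) (x *+ 2 + y)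
  + cyclo_symbol p z N (x *+ 2 + y) (x + y *+ 2)
  = cyclo_symbol p z N x y *+ 3 + cyclo_symbol p z N (x *+ 3) (y *+ 3).
Proof.
move=> p3 x0 y0; have x30 := Zp_mulrn_neq0 (q := 3) isT p3 x0.
have y30 := Zp_mulrn_neq0 (q := 3) isT p3 y0.
have [xy0|xy0] := eqVneq (x + y) 0.
  have -> : y = - x by apply/eqP; rewrite -addr_eq0 addrC xy0.
  have -> : x + - x *+ 2 = - x by zmod.
  have -> : x *+ 2 + - x = x by zmod.
  rewrite subrr cyclo_symbol0l cyclo_symbol0r mulNrn.
  rewrite !cyclo_symbolNr !cyclo_symbolNl !cyclo_symbolxx.
  rewrite (cyclo_symbolC (x *+ 3) x).
  by move: (cyclo_symbol p z N x _) => a; zmod.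
(* The second degenerate case, y = -2x, is the one covered by [cyclo_symbol_hecke3_diag]. *)
have [yE|xxy0] := eqVneq (x *+ 2 + y) 0.
  have {yE}ey : y = - (x *+ 2) by apply/eqP; rewrite -addr_eq0 addrC yE.
  rewrite ey oppr_eq0 in y0 *.
  have -> : x - x *+ 2 = - x by zmod.
  have -> : - (x *+ 2) *+ 3 = - (x *+ 6) by zmod.
  have -> : x + - (x *+ 2) *+ 2 = - (x *+ 3) by zmod.
  rewrite subrr cyclo_symbol0l cyclo_symbol0r !cyclo_symbolNr !cyclo_symbolNl.
  have := cyclo_symbol_hecke3_diag p3 x0 y0.
  move: (cyclo_symbol p z N x (x *+ 6)) (cyclo_symbol p z N (x *+ 3) (x *+ 6)).
  move: (cyclo_symbol p z N (x *+ 3) (x *+ 2)) (cyclo_symbol p z N (x *+ 3) x).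
  move: (cyclo_symbol p z N x (x *+ 2)) => a b c d f h.
  by apply: (eq_add_hyp h); zmod.
(* Mirror image of the previous case, with the roles of x and y exchanged by antisymmetry. *)
have [xE|xyy0] := eqVneq (x + y *+ 2) 0.
  have {xE}ex : x = - (y *+ 2) by apply/eqP; rewrite -addr_eq0 xE.
  rewrite ex oppr_eq0 in x0 *.
  have -> : - (y *+ 2) + y = - y by zmod.
  have -> : - (y *+ 2) *+ 3 = - (y *+ 6) by zmod.
  have -> : - (y *+ 2) *+ 2 + y = - (y *+ 3) by zmod.
  have -> : - (y *+ 2) + y *+ 2 = 0 by zmod.
  rewrite cyclo_symbol0l cyclo_symbol0r !cyclo_symbolNr !cyclo_symbolNl.
  rewrite (cyclo_symbolC (y *+ 2)) (cyclo_symbolC y (y *+ 3)).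
  rewrite (cyclo_symbolC (y *+ 6) y) (cyclo_symbolC (y *+ 2) y).
  have := cyclo_symbol_hecke3_diag p3 y0 x0.
  move: (cyclo_symbol p z N y (y *+ 6)) (cyclo_symbol p z N (y *+ 6) (y *+ 3)).
  move: (cyclo_symbol p z N (y *+ 3) (y *+ 2)) (cyclo_symbol p z N (y *+ 3) y).
  move: (cyclo_symbol p z N y (y *+ 2)) => a b c d f h.
  by apply: (eq_add_hyp (esym h)); zmod.
have xy30 := Zp_mulrn_neq0 (q := 3) isT p3 xy0.
have o w := @orth_zexp p n hp hn L z hz w.
have := cyclo_hecke3 (zeta_unit hp hn hz) (flat_zexp hp hn hz x)
  (flat_zexp hp hn hz y) (o _ x0) (o _ y0).
rewrite -!(zexpMn hp hn hz) -!(zexpD hp hn hz) -!(zexpMn hp hn hz).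
move=> /(_ (o _ xy0) (o _ xxy0) (o _ xyy0) (o _ x30) (o _ y30) (o _ xy30)).
by rewrite -!cyclo_symbolE.
Qed.

End GaloisAction.

                                                                        

(** * Integral 2 x 2 matrices acting on the projective line *)

Lemma mx2_00 a b c d : mx2 a b c d 0 0 = a. Proof. by rewrite mxE. Qed.
Lemma mx2_01 a b c d : mx2 a b c d 0 1 = b. Proof. by rewrite mxE. Qed.
Lemma mx2_10 a b c d : mx2 a b c d 1 0 = c. Proof. by rewrite mxE. Qed.
Lemma mx2_11 a b c d : mx2 a b c d 1 1 = d. Proof. by rewrite mxE. Qed.
Definition mx2E := (mx2_00, mx2_01, mx2_10, mx2_11).

Lemma mx2_eta (g : 'M[int]_2) : g = mx2 (g 0 0) (g 0 1) (g 1 0) (g 1 1).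
Proof.
have ord2 (i : 'I_2) : i = 0 \/ i = 1.
  by case: i => -[|[|//]] h; [left | right]; apply: val_inj.
by apply/matrixP => i j; case: (ord2 i) (ord2 j) => -> [] ->; rewrite mx2E.
Qed.

Lemma mul_mx2 a b c d a' b' c' d' : mx2 a b c d *m mx2 a' b' c' d' =
  mx2 (a * a' + b * c') (a * b' + b * d') (c * a' + d * c') (c * b' + d * d').
Proof. by rewrite [LHS]mx2_eta !mxE !big_ord_recl !big_ord0 !addr0 !mxE. Qed.

Lemma det_mx2 a b c d : \det (mx2 a b c d) = a * d - b * c.
Proof.
rewrite (expand_det_row _ 0) !big_ord_recl big_ord0 addr0 /cofactor !det_mx11 !mxE /=.
by rewrite expr0 expr1 mul1r mulN1r mulrN.
Qed.

Lemma mx2_1 : mx2 1 0 0 1 = 1%:M.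
Proof. by rewrite [RHS]mx2_eta !mxE. Qed.

(** The point with homogeneous coordinates (u : v); (0, 0) also goes to infinity, whence the side
    condition of [mobius_toP1]. *)
Definition toP1 (u v : rat) : P1Q := if v == 0 then None else Some (u / v).

Lemma mobius_None g : mobius g None = toP1 (g 0 0)%:~R (g 1 0)%:~R.
Proof. by rewrite /mobius !mulr0 !mulr1 !addr0. Qed.

Lemma mobius_Some g t : mobius g (Some t) =
  toP1 ((g 0 0)%:~R * t + (g 0 1)%:~R) ((g 1 0)%:~R * t + (g 1 1)%:~R).
Proof. by rewrite /mobius !mulr1. Qed.

Lemma mobius_toP1 g (u v : rat) : (u, v) != (0, 0) -> mobius g (toP1 u v) =
  toP1 ((g 0 0)%:~R * u + (g 0 1)%:~R * v) ((g 1 0)%:~R * u + (g 1 1)%:~R * v).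
Proof.
rewrite {1}/toP1; have [->|v0 _] := eqVneq v 0; last first.
  rewrite mobius_Some /toP1.
  have -> x y : x * (u / v) + y = (x * u + y * v) / v :> rat by field.
  have -> x y : x * (u / v) + y = (x * u + y * v) / v :> rat by field.
  rewrite mulf_eq0 invr_eq0 (negPf v0) orbF; case: ifP => // /negbT den0.
  by congr Some; field; rewrite den0 v0.
rewrite xpair_eqE eqxx andbT => u0; rewrite mobius_None /toP1 !mulr0 !addr0.
rewrite mulf_eq0 (negPf u0) orbF; case: ifP => // /negbT den0.
by congr Some; field; rewrite den0 u0.
Qed.

(** An invertible h maps nonzero coordinates to nonzero ones, so the intermediate point is a genuine
    point of the projective line. *)
Lemma mobius_mulmx g h r : \det h != 0 -> mobius (g *m h) r = mobius g (mobius h r).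
Proof.
rewrite [g]mx2_eta [h]mx2_eta; move: (g 0 0) (g 0 1) (g 1 0) (g 1 1) => a b c d.
move: (h 0 0) (h 0 1) (h 1 0) (h 1 1) => a' b' c' d'; rewrite det_mx2 mul_mx2 => D0.
have {}D0 : a'%:~R * d'%:~R - b'%:~R * c'%:~R != 0 :> rat.
  by rewrite -!intrM -intrB intr_eq0.
case: r => [t|].
  rewrite !mobius_Some !mx2E mobius_toP1 ?mx2E; last first.
    apply: contra D0; rewrite xpair_eqE => /andP[/eqP h1 /eqP h2].
    have -> : b'%:~R = - (a'%:~R * t) :> rat by apply/eqP; rewrite -addr_eq0 addrC h1.
    have -> : d'%:~R = - (c'%:~R * t) :> rat by apply/eqP; rewrite -addr_eq0 addrC h2.
    by apply/eqP; ring.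
  by rewrite !intrD !intrM; congr toP1; ring.
rewrite !mobius_None !mx2E mobius_toP1 ?mx2E; last first.
  apply: contra D0; rewrite xpair_eqE => /andP[/eqP -> /eqP ->].
  by rewrite mul0r mulr0 subrr.
by rewrite !intrD !intrM.
Qed.

Lemma toP1N (u v : rat) : toP1 (- u) (- v) = toP1 u v.
Proof. by rewrite /toP1 oppr_eq0 invrN mulrNN. Qed.

                                

(** * Functions on cusps extended to divisors *)

Section FreegLift.

Context (K : choiceType) (V : zmodType).

                                                                                   
(** [zmodule V] views the abelian group V as a module over the integers, as [fglift] expects. *)
Definition fgsum (f : K -> V) (D : {freeg K / int}) : V :=
  fglift (f : K -> zmodule V) D.

Lemma fgsum_is_zmod_morphism f : zmod_morphism (fgsum f).
Proof. by move=> D E; exact: (lift_is_additive (f : K -> zmodule V)). Qed.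

HB.instance Definition _ f :=
  GRing.isZmodMorphism.Build {freeg K / int} V (fgsum f) (fgsum_is_zmod_morphism f).

Lemma fgsum_gen f x : fgsum f (freeg_gen x) = f x.
Proof. by rewrite /fgsum /freeg_gen liftU scale1r. Qed.

Lemma fgsum_cst (v : V) D : fgsum (fun=> v) D = v *~ deg D.
Proof.
have hm : zmod_morphism (fun D : {freeg K / int} => v *~ deg D).
  by move=> x y; rewrite raddfB mulrzBr.
pose m : {additive {freeg K / int} -> V} :=
  HB.pack (fun D : {freeg K / int} => v *~ deg D)
    (GRing.isZmodMorphism.Build _ _ _ hm).
by apply: (@freeg_ext _ _ (fgsum _) m) => x /=; rewrite fgsum_gen degU mulr1z.
Qed.

End FreegLift.

Lemma div0_valD (D D' : div0) : val (D + D') = val D + val D'.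
Proof. by []. Qed.

Lemma div0_act_mulmx g h D : \det h != 0 -> div0_act (g *m h) D = div0_act g (div0_act h D).
Proof.
move=> h0; apply: val_inj => /=; rewrite -[RHS]freeg_map_comp.
by apply: eq_freeg_map => r /=; apply: mobius_mulmx.
Qed.

Lemma div0_act_inf_0 (g : 'M[int]_2) : val (div0_act g div_inf_0) =
  freeg_gen (toP1 (g 0 0)%:~R (g 1 0)%:~R) - freeg_gen (toP1 (g 0 1)%:~R (g 1 1)%:~R).
Proof.
by rewrite /= raddfB /= !freeg_map_gen mobius_None mobius_Some !mulr0 !add0r.
Qed.

                            

(** * Rows modulo p^n and their lifts to SL_2(Z) *)

Section Residues.

Context (p n : nat) (hp : prime p) (hn : (1 <= n)%N).
Local Notation N := (p ^ n)%N.

Let N_gt1 : (1 < N)%N. Proof. by rewrite -(exp1n n) ltn_exp2r // prime_gt1. Qed.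

Lemma Zp_intr_eq0 (c : int) : (c%:~R == 0 :> 'Z_N) = (N%:Z %| c)%Z.
Proof.
have natP (k : nat) : (k%:R == 0 :> 'Z_N) = (N %| k)%N.
  by rewrite -val_eqE /= val_Zp_nat.
by case: c => k; rewrite ?NegzE ?mulrNz ?oppr_eq0 -pmulrn natP dvdzE ?abszN.
Qed.

Lemma Zp_unit_dvd (x : 'Z_N) : (x \is a GRing.unit) = ~~ (p %| x)%N.
Proof.
by rewrite -{1}[x]natr_Zp unitZpE // coprime_pexpl // prime_coprime.
Qed.

Lemma in_XnE (x y : 'Z_N) :
  in_Xn x y = (x \is a GRing.unit) || (y \is a GRing.unit).
Proof.
rewrite /in_Xn -/(coprime _ p) coprime_sym prime_coprime // dvdn_gcd negb_and.
by rewrite !Zp_unit_dvd.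
Qed.

Lemma in_XnP (x y : 'Z_N) : in_Xn x y <-> exists u v : 'Z_N, u * x + v * y = 1.
Proof.
rewrite in_XnE; split=> [/orP[ux|uy]|[u [v uv1]]].
- by exists x^-1, 0; rewrite mulVr // mul0r addr0.
- by exists 0, y^-1; rewrite mulVr // mul0r add0r.
rewrite -[_ || _]negbK negb_or !Zp_unit_dvd !negbK; apply/negP => /andP[px py].
have : ((u * x + v * y)%N %% N = 1 %% N)%N.
  rewrite -[LHS](val_Zp_nat N_gt1) -[RHS](val_Zp_nat N_gt1) natrD !natrM !natr_Zp.
  by rewrite uv1.
move=> /(congr1 (fun k => k %% p)%N); rewrite !modn_dvdm ?dvdn_exp // => h.
have : (p %| u * x + v * y)%N by rewrite dvdn_add // dvdn_mull.
by rewrite /dvdn h modn_small ?prime_gt1.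
Qed.

Lemma in_XnM (l x y : 'Z_N) : l \is a GRing.unit -> in_Xn x y -> in_Xn (l * x) (l * y).
Proof.
move=> ul /in_XnP[u [v uv1]]; apply/in_XnP; exists (u * l^-1), (v * l^-1).
by rewrite !mulrA !divrK.
Qed.

Lemma in_Xn_int (a b c d : int) : a * d - b * c = 1 ->
  in_Xn (c%:~R : 'Z_N) (d%:~R : 'Z_N).
Proof.
move=> D1; apply/in_XnP; exists (- b%:~R), a%:~R.
by rewrite -[RHS]/(1%:~R) -D1 intrB !intrM; ring.
Qed.

(** If y is a unit mod N, its representative is coprime to N, and the Chinese remainder theorem
    gives c congruent to x modulo N and to 1 modulo that representative. *)
Lemma coprime_lift (x y : 'Z_N) : in_Xn x y -> exists c d : nat,
  [/\ coprime c d, c%:R = x & d%:R = y].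
Proof.
have crt (u v : 'Z_N) : v \is a GRing.unit -> exists2 c : nat, coprime c v & c%:R = u.
  move=> uv; have co : coprime N v by rewrite -unitZpE // natr_Zp.
  exists (chinese N v u 1).
    by rewrite -coprime_modl chinese_modr // coprime_modl coprime1n.
  apply: val_inj; rewrite /= val_Zp_nat // chinese_modl // modn_small //.
  by have := ltn_ord u; rewrite [X in (_ < X)%N -> _](Zp_cast N_gt1).
rewrite in_XnE => /orP[ux|uy].
- by have [d co <-] := crt y x ux; exists x, d; rewrite coprime_sym natr_Zp.
- by have [c co <-] := crt x y uy; exists c, y; rewrite natr_Zp.
Qed.

Lemma lift_SL2P (x y : 'Z_N) : in_Xn x y ->
  [/\ \det (lift_SL2 x y) = 1, (lift_SL2 x y 1 0)%:~R = x & (lift_SL2 x y 1 1)%:~R = y].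
Proof.
move=> /coprime_lift[c [d [co ex ey]]].
have hP : exists g : 'M[int]_2, [/\ \det g = 1, (g 1 0)%:~R = x & (g 1 1)%:~R = y].
  have [u [v]] := Bezoutz c%:Z d%:Z; rewrite /gcdz /= (eqP co) => uv1.
  exists (mx2 v (- u) c%:Z d%:Z); rewrite det_mx2 !mx2E -ex -ey; split=> //.
  by rewrite -[RHS]uv1; ring.
exact: (epsilon_spec (inhabits 1%:M) _ hP).
Qed.

End Residues.

                                          

(** * Integration along the Farey graph *)

(** Reduce a Bezout coefficient modulo c: b/d is the Farey neighbour of a/c of smaller denominator,
    the step of a descent to infinity. *)
Lemma SL2_parent (a c : int) : 0 < c -> coprimez a c ->
  exists2 bd : int * int, a * bd.2 - bd.1 * c = 1 & 0 <= bd.2 < c.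
Proof.
move=> c0 co; have [u [v]] := Bezoutz a c; rewrite (eqP co) => uv1.
exists (- v - a * (u %/ c)%Z, (u %% c)%Z) => /=; last first.
  by apply/andP; split; [apply: modz_ge0; lia | exact: ltz_pmod].
by rewrite -[RHS]uv1 {3}(divz_eq u c); ring.
Qed.

Lemma SL2_parent_uniq (a b c d b' d' : int) :
  a * d - b * c = 1 -> a * d' - b' * c = 1 -> 0 <= d < c -> 0 <= d' < c ->
  b = b' /\ d = d'.
Proof.
move=> D D' dc dc'.
have e : d - d' = c * (b * d' - b' * d).
  transitivity (d * (a * d' - b' * c) - d' * (a * d - b * c)).
    by rewrite D D' !mulr1.
  by ring.
have e0 : b * d' - b' * d = 0.
  by move: (b * d' - b' * d) e => k e; nia.
have ed : d = d' by move: e; rewrite e0 mulr0; lia.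
split=> //; rewrite -ed in D'; have c0 : c != 0 by lia.
apply: (mulIf c0); transitivity (a * d - 1); first by rewrite -D; ring.
by rewrite -D'; ring.
Qed.

Definition parent (a c : int) : int * int :=
  epsilon (inhabits (0, 0))
    (fun bd => a * bd.2 - bd.1 * c = 1 /\ 0 <= bd.2 < c).

Lemma parentP (a b c d : int) : a * d - b * c = 1 -> 0 <= d < c -> parent a c = (b, d).
Proof.
move=> D dc.
have hP : exists bd : int * int, a * bd.2 - bd.1 * c = 1 /\ 0 <= bd.2 < c.
  by exists (b, d).
have [] := epsilon_spec (inhabits (0, 0)) _ hP; rewrite -/(parent a c).
case: (parent a c) => b' d' /= D' dc'.
by have [-> ->] := SL2_parent_uniq D' D dc' dc.
Qed.

Lemma det1_coprimez (a b c d : int) : a * d - b * c = 1 -> coprimez a c.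
Proof.
by move=> D; apply/coprimezP; exists (d, - b) => /=; rewrite -D; ring.
Qed.

Lemma toP1_fracE (a c : int) : 0 < c -> coprimez a c ->
  toP1 a%:~R c%:~R = Some (a%:~R / c%:~R) /\
  numq (a%:~R / c%:~R) = a /\ denq (a%:~R / c%:~R) = c.
Proof.
move=> c0 co; rewrite /toP1 intr_eq0 gt_eqF //; split=> //.
by rewrite coprimeq_num // coprimeq_den // gtr0_sg // mul1r gt_eqF // gtr0_norm.
Qed.

Lemma rat_fracE (r : rat) : exists a c : int,
  [/\ 0 < c, coprimez a c, Some r = toP1 a%:~R c%:~R & c = denq r].
Proof.
exists (numq r), (denq r); rewrite denq_gt0; split=> //; first exact: coprime_num_den.
by rewrite /toP1 intr_eq0 denq_eq0 divq_num_den.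
Qed.

Lemma farey_connected (T : Type) (h : P1Q -> T) :
  (forall a b c d : int, a * d - b * c = 1 ->
     h (toP1 a%:~R c%:~R) = h (toP1 b%:~R d%:~R)) ->
  forall r, h r = h None.
Proof.
move=> hE [r|//]; have [a [c [c0 co -> _]]] := rat_fracE r => {r}.
have [k lt_ck] := ubnP `|c|%N; elim: k => // k IHk in a c c0 co lt_ck *.
have [[b d] /= D /andP[d0 ltd]] := SL2_parent c0 co; rewrite (hE _ _ _ _ D).
have [->|d_neq0] := eqVneq d 0; first by rewrite /toP1 eqxx.
have dpos : 0 < d by rewrite lt_neqAle eq_sym d_neq0.
apply: IHk => //; last by lia.
by apply/coprimezP; exists (- c, a) => /=; rewrite -D; ring.
Qed.

Section FareyPotential.

Context (M : zmodType) (E : int -> int -> M).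

Hypothesis E2 : forall a b c d : int, a * d - b * c = 1 -> E c d + E d (- c) = 0.
Hypothesis E3 : forall a b c d : int, a * d - b * c = 1 ->
  E c d + E d (- c - d) + E (- c - d) c = 0.

                                                  
(** A primitive of E vanishing at infinity: E is summed along the chain of parents of a/c. The
    argument k is fuel; |c| + 1 is enough since denominators strictly decrease. *)
Fixpoint potential_rec (k : nat) (a c : int) : M :=
  if k is k'.+1 then
    if c == 0 then 0 else potential_rec k' (parent a c).1 (parent a c).2 + E c (parent a c).2
  else 0.

Definition potential (r : P1Q) : M :=
  if r is Some t then potential_rec `|denq t|.+1 (numq t) (denq t) else 0.

Lemma potential_rec_stable (k k' : nat) (a b c d : int) :
  a * d - b * c = 1 -> 0 <= c -> (`|c| < k)%N -> (`|c| < k')%N ->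
  potential_rec k a c = potential_rec k' a c.
Proof.
elim: k k' a b c d => // k IHk [//|k'] a b c d D c0 ck ck' /=.
have [//|cn0] := eqVneq c 0; have cpos : 0 < c by rewrite lt_neqAle eq_sym cn0.
have [[b' d'] /= D' dc'] := SL2_parent cpos (det1_coprimez D).
rewrite (parentP D' dc') /=; congr (_ + _).
by apply: (IHk _ _ (- a) _ (- c)); [rewrite -D'; ring | lia..].
Qed.

Lemma potentialE (a c : int) : 0 < c -> coprimez a c ->
  potential (toP1 a%:~R c%:~R) = potential_rec `|c|.+1 a c.
Proof. by move=> c0 co; have [-> [en ed]] := toP1_fracE c0 co; rewrite /potential en ed. Qed.

Lemma potential_parent (a b c d : int) : a * d - b * c = 1 -> 0 <= d < c ->
  potential (toP1 a%:~R c%:~R) = potential (toP1 b%:~R d%:~R) + E c d.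
Proof.
move=> D dc; have c0 : 0 < c by lia.
rewrite (potentialE c0 (det1_coprimez D)) [LHS]/= gt_eqF // (parentP D dc) [LHS]/=.
congr (_ + _); have [d0|dn0] := eqVneq d 0.
  by rewrite d0 /toP1 eqxx; case: `|c|%N => // k /=.
have dpos : 0 < d by lia.
have D' : b * - c - (- a) * d = 1 by rewrite -D; ring.
rewrite (potentialE dpos (det1_coprimez D')).
by apply: (potential_rec_stable D'); lia.
Qed.

Lemma farey_oppr (a b c d : int) : a * d - b * c = 1 -> E (- c) (- d) = E c d.
Proof.
move=> D; have h1 := E2 D.
have h2 : E d (- c) + E (- c) (- d) = 0 by apply: (E2 (a := b) (b := - a)); rewrite -D; ring.
by apply: (eq_add_hyp h2); apply: (eq_add_hyp (esym h1)); zmod.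
Qed.

(** If d < c, then b/d is the parent of a/c. Otherwise (b - a)/(d - c) completes a Farey triangle:
    it is the parent of b/d, its edge to a/c is known by induction, and the three-term relation
    gives the third side. *)
Lemma potential_edge_nneg (a b c d : int) : a * d - b * c = 1 -> 0 < c -> 0 <= d ->
  potential (toP1 a%:~R c%:~R) - potential (toP1 b%:~R d%:~R) = E c d.
Proof.
have [k lt_dk] := ubnP `|d|%N; elim: k => // k IHk in a b c d lt_dk *.
move=> D c0 d0; have [ltdc|lecd] := ltP d c.
  by rewrite (potential_parent D) ?d0 // addrAC subrr add0r.
have D1 : b * (d - c) - (b - a) * d = 1 by rewrite -D; ring.
have D2 : a * (d - c) - (b - a) * c = 1 by rewrite -D; ring.
have h1 : potential (toP1 b%:~R d%:~R)
    = potential (toP1 (b - a)%:~R (d - c)%:~R) + E d (d - c).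
  by apply: potential_parent => //; lia.
have h2 := IHk a (b - a) c (d - c) ltac:(lia) D2 c0 ltac:(lia).
have h3 := E3 D2; rewrite (_ : - c - (d - c) = - d) in h3; last by ring.
have h4 := E2 D1.
have h5 : E (- d) c = E d (- c).
  rewrite -{1}[c]opprK; apply: (farey_oppr (a := b) (b := - a)); rewrite -D; ring.
have h6 := E2 D.
have h7 : E (d - c) (- d) = - E d (d - c) by apply/eqP; rewrite -addr_eq0 addrC h4.
move: h1 h2 h3 h5 h6; rewrite h7 => h1 h2 h3 h5 h6.
apply: (eq_add_hyp (esym h1)); apply: (eq_add_hyp h2); apply: (eq_add_hyp h3).
by apply: (eq_add_hyp (esym h5)); apply: (eq_add_hyp (esym h6)); zmod.
Qed.

(** Negating both columns, and swapping columns with one sign change, reduce to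
    [potential_edge_nneg]; E follows by the two-term relation. *)
Lemma potential_edge (a b c d : int) : a * d - b * c = 1 ->
  potential (toP1 a%:~R c%:~R) - potential (toP1 b%:~R d%:~R) = E c d.
Proof.
have tN (x y : int) : toP1 (- x)%:~R (- y)%:~R = toP1 x%:~R y%:~R.
  by rewrite !mulrNz toP1N.
wlog c0 : a b c d / 0 <= c => [IH D|].
  have [/IH|c_lt0] := lerP 0 c; first exact.
  rewrite -(farey_oppr D) -(tN a) -(tN b); apply: IH; first by lia.
  by rewrite -D; ring.
move=> D; have [cpos|cneg|cz] := ltrgt0P c; last 2 first.
- by lia.
- move: D; rewrite {}cz mulr0 subr0 => D {c c0}.
  (* Here a/c is infinity; once d is positive, swapping the columns makes it the second vertex. *)
  wlog d0 : a b d D / 0 < d => [IH|].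
    have [/(IH _ _ _ D)|d_le0] := ltrP 0 d; first exact.
    have -> : E 0 d = E (- 0) (- d).
      by rewrite (farey_oppr (a := a) (b := b)) // -D; ring.
    rewrite oppr0 -(tN a) -(tN b) oppr0; apply: IH; first by rewrite -D; ring.
    rewrite oppr_gt0 lt_neqAle d_le0 andbT.
    by apply: contra_eq_neq D => ->; rewrite mulr0.
  have D' : b * 0 - (- a) * d = 1 by rewrite -D; ring.
  have h := potential_edge_nneg D' d0 (lexx 0).
  rewrite (_ : toP1 (- a)%:~R 0%:~R = toP1 a%:~R 0%:~R) in h; last by rewrite /toP1 eqxx.
  have h2 : E 0 d + E d 0 = 0.
    by rewrite -[X in E d X]oppr0; apply: (E2 (a := a) (b := b)); rewrite -D; ring.
  move: h h2; move: (potential (toP1 b%:~R _)) (potential (toP1 a%:~R _)) (E 0 d) (E d 0).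
  move=> u v w t h h2.
  by apply: (eq_add_hyp (esym h2)); apply: (eq_add_hyp (esym h)); zmod.
have [d0|d_lt0] := lerP 0 d; first exact: potential_edge_nneg.
have D' : (- b) * c - a * (- d) = 1 by rewrite -D; ring.
have h := potential_edge_nneg D' ltac:(lia) (ltW cpos); rewrite tN in h.
have h2 := E2 D.
have h3 : E (- d) (- - c) = E d (- c) by apply: (farey_oppr (a := b) (b := - a)); rewrite -D; ring.
rewrite opprK in h3.
by apply: (eq_add_hyp (esym h2)); apply: (eq_add_hyp (esym h)); apply: (eq_add_hyp (esym h3)); zmod.
Qed.

End FareyPotential.

(** * Cosets of matrices of determinant q *)

Definition adj2 (g : 'M[int]_2) := mx2 (g 1 1) (- g 0 1) (- g 1 0) (g 0 0).

Lemma det2E (g : 'M[int]_2) : \det g = g 0 0 * g 1 1 - g 0 1 * g 1 0.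
Proof. by rewrite [in LHS](mx2_eta g) det_mx2. Qed.

Lemma mulmx2E (g h : 'M[int]_2) i j : (g *m h) i j = g i 0 * h 0 j + g i 1 * h 1 j.
Proof.
by rewrite mxE !big_ord_recl big_ord0 addr0; congr (_ * h _ _ + g _ _ * h _ _); apply: val_inj.
Qed.

Lemma mulmx_adj2 g : \det g = 1 -> g *m adj2 g = 1%:M.
Proof.
rewrite det2E => D; rewrite -mx2_1 /adj2 [X in X *m _]mx2_eta mul_mx2.
by congr mx2; rewrite -?D; ring.
Qed.

Lemma mul_adj2mx g : \det g = 1 -> adj2 g *m g = 1%:M.
Proof.
rewrite det2E => D; rewrite -mx2_1 /adj2 [X in _ *m X]mx2_eta mul_mx2.
by congr mx2; rewrite -?D; ring.
Qed.

Lemma det_adj2 g : \det (adj2 g) = \det g.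
Proof. by rewrite det_mx2 det2E; ring. Qed.

Lemma Gamma0M N g h : Gamma0 N g -> Gamma0 N h -> Gamma0 N (g *m h).
Proof.
move=> [Dg cg] [Dh ch]; split; first by rewrite det_mulmx Dg Dh mulr1.
by rewrite mulmx2E; apply: rpredD; [exact: dvdz_mulr | exact: dvdz_mull].
Qed.

Lemma Gamma0V N g : Gamma0 N g -> Gamma0 N (adj2 g).
Proof. by move=> [Dg cg]; split; rewrite ?det_adj2 // mx2E rpredN. Qed.

Lemma Gamma0_1 N : Gamma0 N 1%:M.
Proof. by rewrite -mx2_1; split; rewrite ?det_mx2 ?mx2E ?dvdz0. Qed.

Lemma double_cosetM N m d g : double_coset N m d -> Gamma0 N g ->
  double_coset N m (d *m g).
Proof.
by move=> [h [k [hh hk ->]]] hg; exists h, (k *m g); split; rewrite ?mulmxA //; exact: Gamma0M.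
Qed.

Lemma det_double_coset N m d : double_coset N m d -> \det d = m%:Z.
Proof.
by move=> [g [h [[Dg _] [Dh _] ->]]]; rewrite !det_mulmx Dg Dh det_mx2; ring.
Qed.

Lemma coset_reps_mulr N m s g : is_coset_reps N m s -> Gamma0 N g ->
  is_coset_reps N m [seq d *m g | d <- s].
Proof.
move=> [us sDC repP] hg; have [hgV Dg] := (Gamma0V hg, proj1 hg).
have gK (d : 'M_2) : d *m g *m adj2 g = d by rewrite -mulmxA mulmx_adj2 // mulmx1.
have gVK (d : 'M_2) : d *m adj2 g *m g = d by rewrite -mulmxA mul_adj2mx // mulmx1.
split=> [|d /mapP[e es ->]|d dDC].
- by rewrite map_inj_uniq //; exact: (can_inj (g := mulmx^~ (adj2 g))) gK.
- exact: double_cosetM (sDC e es) hg.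
have [e [[es [h hh de]] e_uniq]] := repP _ (double_cosetM dDC hgV).
exists (e *m g); split.
  by split; [exact: map_f | exists h => //; rewrite mulmxA -de gVK].
move=> _ [/mapP[e' e's ->] [h' hh' de']]; congr (_ *m g); apply: e_uniq.
by split=> //; exists h' => //; rewrite de' mulmxA gK.
Qed.

(** Representatives, for q prime, of the left SL_2(Z)-cosets of integral matrices of determinant q.
    The sign in -j makes x j + y appear in the Manin symbols later. *)
Definition hermite (q : nat) : seq 'M[int]_2 :=
  mx2 q%:Z 0 0 1 :: [seq mx2 1 (- j%:Z) 0 q%:Z | j <- iota 0 q].

Lemma dvdz_prime_mull (q : nat) (x y : int) : prime q ->
  (q%:Z %| x * y)%Z -> ~~ (q%:Z %| x)%Z -> (q%:Z %| y)%Z.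
Proof. by move=> hq; rewrite !dvdzE abszM /= Euclid_dvdM // => /orP[->|]. Qed.

Lemma linear_congruence (q : nat) (x y : int) : prime q -> ~~ (q%:Z %| x)%Z ->
  exists2 j : nat, (j < q)%N & (q%:Z %| x * j%:Z + y)%Z.
Proof.
move=> hq qx; have q0 : 0 < q%:Z by rewrite ltz_nat prime_gt0.
have co : gcdz x q%:Z = 1.
  by rewrite /gcdz gcdnC; congr Posz; apply/eqP; rewrite -/(coprime _ _) prime_coprime.
have [u [v]] := Bezoutz x q%:Z; rewrite co => uv1.
have hr : 0 <= ((- y * u) %% q%:Z)%Z by apply: modz_ge0; lia.
exists `|((- y * u) %% q%:Z)%Z|%N.
  by have := ltz_pmod (- y * u) q0; lia.
rewrite gez0_abs //; apply/dvdzP; exists (v * y - x * ((- y * u) %/ q%:Z)%Z).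
have e := divz_eq (- y * u) q%:Z.
have -> : ((- y * u) %% q%:Z)%Z = - y * u - ((- y * u) %/ q%:Z)%Z * q%:Z by lia.
by rewrite -[in X in _ + X](mulr1 y) -uv1; ring.
Qed.

Lemma hermite_ex (q : nat) (A : 'M[int]_2) : prime q -> \det A = q%:Z ->
  exists2 h, h \in hermite q & exists2 k, \det k = 1 & A = k *m h.
Proof.
move=> hq; rewrite det2E [A]mx2_eta !mx2E; move: (A 0 0) (A 0 1) (A 1 0) (A 1 1).
move=> a b c d D; have q0 : q%:Z != 0 by rewrite eqz_nat -lt0n prime_gt0.
have main (j : nat) : (j < q)%N -> (q%:Z %| a * j%:Z + b)%Z -> (q%:Z %| c * j%:Z + d)%Z ->
    exists2 h, h \in hermite q & exists2 k, \det k = 1 & mx2 a b c d = k *m h.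
  move=> ltj /dvdzP[u eu] /dvdzP[v ev]; exists (mx2 1 (- j%:Z) 0 q%:Z).
    by rewrite inE; apply/orP; right; apply/mapP; exists j; rewrite ?mem_iota.
  have eb : b = u * q%:Z - a * j%:Z by rewrite -eu; ring.
  have ed : d = v * q%:Z - c * j%:Z by rewrite -ev; ring.
  exists (mx2 a u c v); last by rewrite mul_mx2 eb ed; congr mx2; ring.
  by rewrite det_mx2; apply: (mulIf q0); rewrite mul1r -[RHS]D eb ed; ring.
have [qa|qa] := boolP (q%:Z %| a)%Z; last first.
  have [j ltj hj] := linear_congruence b hq qa; apply: (main j ltj hj).
  apply: (dvdz_prime_mull hq _ qa).
  have -> : a * (c * j%:Z + d) = c * (a * j%:Z + b) + q%:Z by rewrite -D; ring.
  by rewrite rpredD ?dvdz_mull ?dvdzz.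
have [qc|qc] := boolP (q%:Z %| c)%Z; last first.
  have [j ltj hj] := linear_congruence d hq qc; apply: (main j ltj) => //.
  apply: (dvdz_prime_mull hq _ qc).
  have -> : c * (a * j%:Z + b) = a * (c * j%:Z + d) - q%:Z by rewrite -D; ring.
  by rewrite rpredB ?dvdz_mull ?dvdzz.
have [[a' ea] [c' ec]] := (dvdzP qa, dvdzP qc).
exists (mx2 q%:Z 0 0 1); first by rewrite inE eqxx.
exists (mx2 a' b c' d); last by rewrite mul_mx2 ea ec; congr mx2; ring.
by rewrite det_mx2; apply: (mulIf q0); rewrite mul1r -[RHS]D ea ec; ring.
Qed.

Lemma hermite_uniq (q : nat) (h h' k : 'M[int]_2) : prime q ->
  h \in hermite q -> h' \in hermite q -> \det k = 1 -> h = k *m h' -> h = h'.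
Proof.
move=> hq; have q1 : (1 < q%:Z) by rewrite ltz_nat prime_gt1.
have noinv (a : int) : a * q%:Z <> 1.
  move=> e; have : (q%:Z %| 1)%Z by apply/dvdzP; exists a; rewrite e.
  by rewrite dvdzE /= dvdn1 => /eqP e1; rewrite e1 in hq.
rewrite !inE => hH hH'; rewrite [k]mx2_eta det_mx2.
move: (k 0 0) (k 0 1) (k 1 0) (k 1 1) => a b c d D.
case/orP: hH' => [/eqP->|/mapP[j' lj' ->]]; case/orP: hH => [/eqP->|/mapP[j lj ->]] //.
- rewrite mul_mx2 => /(congr1 (fun g : 'M[int]_2 => g 0 0)).
  by rewrite !mx2E mulr0 addr0 => /esym/noinv.
- rewrite mul_mx2 => e; have ea := congr1 (fun g : 'M[int]_2 => g 0 0) e.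
  have ec := congr1 (fun g : 'M[int]_2 => g 1 0) e.
  move: ea ec D; rewrite !mx2E !mulr0 !mulr1 !addr0 => <- <-.
  by rewrite mulr0 subr0 mulrC => /noinv.
rewrite mul_mx2 => e.
have ea := congr1 (fun g : 'M[int]_2 => g 0 0) e.
have ec := congr1 (fun g : 'M[int]_2 => g 1 0) e.
have eb := congr1 (fun g : 'M[int]_2 => g 0 1) e.
move: ea ec eb lj lj'; rewrite !mx2E !mem_iota /= !mulr0 !mulr1 !addr0 add0n.
move=> <- _ eb lj lj'; rewrite mul1r in eb.
have eb0 : b = 0 by nia.
by move: eb; rewrite eb0 mul0r addr0 => ->.
Qed.

Lemma uniq_hermite (q : nat) : prime q -> uniq (hermite q).
Proof.
move=> hq; rewrite /= map_inj_uniq ?iota_uniq ?andbT => [|i j]; last first.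
  by move=> /(congr1 (fun g : 'M[int]_2 => g 0 1)); rewrite !mx2E => /oppr_inj[].
apply/mapP => -[j _] /(congr1 (fun g : 'M[int]_2 => g 0 0)); rewrite !mx2E => -[] e.
by rewrite e in hq.
Qed.

Lemma det_hermite (q : nat) h : h \in hermite q -> \det h = q%:Z.
Proof.
by rewrite inE => /orP[/eqP->|/mapP[j _ ->]]; rewrite det_mx2; ring.
Qed.

(** If q does not divide the first column, that column is primitive (its gcd divides q), and its
    Bezout relation gives both Gamma_0 factors explicitly. *)
Lemma double_coset_det (N q : nat) (d : 'M[int]_2) : prime q -> coprime q N ->
  \det d = q%:Z -> (N%:Z %| d 1%R 0%R)%Z -> double_coset N q d.
Proof.
move=> hq co_qN; pose P (d : 'M[int]_2) := ~~ ((q%:Z %| d 0%R 0%R)%Z && (q%:Z %| d 1%R 0%R)%Z).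
have main (e : 'M[int]_2) : P e -> \det e = q%:Z -> (N%:Z %| e 1%R 0%R)%Z -> double_coset N q e.
  rewrite /P [e]mx2_eta det_mx2 !mx2E; move: (e 0 0) (e 0 1) (e 1 0) (e 1 1).
  move=> a b c f hP D Nc.
  have g1 : gcdz a c = 1.
    have : (gcdz a c %| q%:Z)%Z.
      rewrite -D; apply: rpredB; first by apply: dvdz_mulr; exact: dvdz_gcdl.
      by apply: dvdz_mull; exact: dvdz_gcdr.
    rewrite dvdzE /= => /(primeP hq).2 /orP[/eqP g1|/eqP gq].
      by rewrite /gcdz /= g1.
    by case/negP: hP; rewrite -gq dvdz_gcdl dvdz_gcdr.
  have [u [v]] := Bezoutz a c; rewrite g1 => uv1.
  exists (mx2 a (- v) c u), (mx2 1 (u * b + v * f) 0 1); split.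
  - by split; rewrite ?mx2E // det_mx2 -uv1; ring.
  - by split; rewrite ?det_mx2 ?mx2E ?dvdz0 //; ring.
  rewrite !mul_mx2; congr mx2; try ring.
  - transitivity (b * (u * a + v * c)); first by rewrite uv1 mulr1.
    by rewrite -D; ring.
  - transitivity (f * (u * a + v * c)); first by rewrite uv1 mulr1.
    by rewrite -D; ring.
move=> D Nd; have [hP|] := boolP (P d); first exact: main.
rewrite /P negbK => /andP[qa qc].
have GN (k : int) : Gamma0 N (mx2 1 0 (k * N%:Z) 1).
  by split; rewrite ?det_mx2 ?mx2E ?dvdz_mull //; ring.
(* If q divides the first column, add N times the second to it. Were q still to divide it, q would
   divide all entries and q^2 would divide the determinant q. *)
have -> : d = d *m mx2 1 0 (1 * N%:Z) 1 *m mx2 1 0 (-1 * N%:Z) 1.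
  rewrite -mulmxA mul_mx2 (_ : mx2 _ _ _ _ = 1%:M) ?mulmx1 // -mx2_1.
  by congr mx2; ring.
apply: double_cosetM (GN _); apply: main; last 2 first.
- by rewrite det_mulmx D det_mx2; ring.
- rewrite mulmx2E !mx2E; apply: rpredD; first exact: dvdz_mulr.
  by apply: dvdz_mull; exact: dvdz_mull.
rewrite /P !mulmx2E !mx2E !mulr1 !mul1r; apply/negP => /andP[ha hc].
have qN : ~~ (q%:Z %| N%:Z)%Z by rewrite dvdzE /= -prime_coprime.
have qb : (q%:Z %| d 0%R 1%R)%Z.
  by apply: (dvdz_prime_mull hq _ qN); rewrite mulrC; move: ha; rewrite rpredDl.
have qd : (q%:Z %| d 1%R 1%R)%Z.
  by apply: (dvdz_prime_mull hq _ qN); rewrite mulrC; move: hc; rewrite rpredDl.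
move: D; rewrite det2E.
have [[a' ->] [b' ->]] := (dvdzP qa, dvdzP qb).
have [[c' ->] [d' ->]] := (dvdzP qc, dvdzP qd) => D.
have q2 : (q%:Z * q%:Z %| q%:Z)%Z.
  by apply/dvdzP; exists (a' * d' - b' * c'); rewrite -[LHS]D; ring.
move: q2; rewrite dvdzE abszM /= => /(dvdn_leq (prime_gt0 hq)).
by rewrite leqNgt -{1}(muln1 q) ltn_pmul2l ?prime_gt0 // prime_gt1.
Qed.

                        

(** * Manin's isomorphism and the stability of modular symbols under Hecke operators *)

Section ManinTheory.

Context (p n : nat) (hp : prime p) (hn : (1 <= n)%N).
Local Notation N := (p ^ n)%N.
Context (M : zmodType) (act : 'Z_N -> M -> M).
Hypothesis actD : forall l, {morph act l : x y / x + y}.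
Hypothesis act1 : act 1 =1 id.
Hypothesis actM : forall l m, l \is a GRing.unit -> m \is a GRing.unit ->
  act (l * m) =1 act l \o act m.

Let N_gt1 : (1 < N)%N. Proof. by rewrite -(exp1n n) ltn_exp2r // prime_gt1. Qed.

Lemma act0 l : act l 0 = 0.
Proof. by apply: (addrI (act l 0)); rewrite -actD !addr0. Qed.

Lemma actB l : {morph act l : x y / x - y}.
Proof.
move=> x y; apply: (addIr (act l y)).
by rewrite -actD !subrK.
Qed.

Lemma act_sum l (I : Type) (s : seq I) (F : I -> M) :
  act l (\sum_(i <- s) F i) = \sum_(i <- s) act l (F i).
Proof. exact: (big_morph _ (actD l) (act0 l)). Qed.

Local Notation zr := (fun c : int => c%:~R : 'Z_N).

Lemma Gamma0_Zp g : Gamma0 N g -> [/\ zr (g 1 0) = 0, zr (g 0 0) * zr (g 1 1) = 1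
  & zr (g 0 0) \is a GRing.unit].
Proof.
move=> [Dg /=]; rewrite -(Zp_intr_eq0 hp hn) => /eqP c0.
have ad1 : zr (g 0 0) * zr (g 1 1) = 1.
  by rewrite -[RHS]/(1%:~R) -Dg det2E intrB !intrM c0 mulr0 subr0.
by split=> //; apply/unitrP; exists (zr (g 1 1)); split; rewrite // mulrC.
Qed.

Lemma double_coset_Zp m d : double_coset N m d ->
  zr (d 1 0) = 0 /\ zr (d 0 0) \is a GRing.unit.
Proof.
move=> [g [h [/Gamma0_Zp[cg _ ug] /Gamma0_Zp[ch _ uh] ->]]].
rewrite !mulmx2E !mx2E !mulr1 !mulr0 !addr0 !intrD !intrM cg ch !mulr0 !addr0.
by rewrite mul0r unitrM ug uh.
Qed.

(** Sum the Farey potential of e over divisors. For g in Gamma_0 the defect h(r) = chi(g) f(g r) -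
    f(r) takes equal values at both ends of each Farey edge, hence is constant and vanishes on
    divisors of degree 0. *)
Lemma modsymb_of_manin e : is_manin p n act e -> exists phi,
  is_modsymb act phi /\ forall x y, in_Xn x y -> manin_of phi x y = e x y.
Proof.
move=> he; pose E (c d : int) := e (zr c) (zr d).
have E2 (a b c d : int) : a * d - b * c = 1 -> E c d + E d (- c) = 0.
  by move=> /(in_Xn_int hp hn)/he[_ h _]; rewrite /E mulrNz.
have E3 (a b c d : int) : a * d - b * c = 1 ->
    E c d + E d (- c - d) + E (- c - d) c = 0.
  by move=> /(in_Xn_int hp hn)/he[_ _ h]; rewrite /E intrB mulrNz.
pose f := potential E.
have fE (a b c d : int) : a * d - b * c = 1 ->
    f (toP1 a%:~R c%:~R) - f (toP1 b%:~R d%:~R) = E c d by exact: potential_edge.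
pose phi (D : div0) : M := fgsum f (val D).
have phiE (g : 'M[int]_2) : \det g = 1 ->
    phi (div0_act g div_inf_0) = E (g 1 0) (g 1 1).
  move=> Dg; rewrite /phi div0_act_inf_0 raddfB /= !fgsum_gen fE //.
  by rewrite -Dg det2E.
exists phi; split; last first.
  move=> x y /(lift_SL2P hp hn)[Dg ex ey]; rewrite /manin_of phiE //.
  by rewrite /E ex ey.
split=> [D D'|g hg D]; first by rewrite /phi raddfB.
have [Dg _] := hg; have [cg ad1 ug] := Gamma0_Zp hg.
pose h r := act (zr (g 0 0)) (f (mobius g r)) - f r.
have hE (a b c d : int) : a * d - b * c = 1 ->
    h (toP1 a%:~R c%:~R) = h (toP1 b%:~R d%:~R).
  move=> D1; have D1' : \det (mx2 a b c d) = 1 by rewrite det_mx2.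
  have tE : toP1 a%:~R c%:~R = mobius (mx2 a b c d) None by rewrite mobius_None !mx2E.
  have tE' : toP1 b%:~R d%:~R = mobius (mx2 a b c d) (Some 0).
    by rewrite mobius_Some !mx2E !mulr0 !add0r.
  have : f (mobius g (toP1 a%:~R c%:~R)) - f (mobius g (toP1 b%:~R d%:~R))
      = act (zr (g 1 1)) (E c d).
    rewrite tE tE' -!mobius_mulmx ?D1' // mobius_None mobius_Some !mulr0 !add0r.
    rewrite fE; last by rewrite -det2E det_mulmx Dg D1' mulr1.
    rewrite !mulmx2E !mx2E /E !intrD !intrM cg !mul0r !add0r.
    have [h1 _ _] := he _ _ (in_Xn_int hp hn D1); apply: h1.
    by apply/unitrP; exists (zr (g 0 0)); split; rewrite // mulrC.
  have := fE _ _ _ _ D1.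
  move=> h1 h2.
  have h3 : act (zr (g 0 0)) (act (zr (g 1 1)) (E c d)) = E c d.
    rewrite -[LHS]/((act _ \o act _) (E c d)) -actM ?ad1 ?act1 //.
    by apply/unitrP; exists (zr (g 0 0)); split; rewrite // mulrC.
  rewrite -h2 actB in h3.
  rewrite /h; move: h1 h3.
  move: (act _ (f _)) => u; move: (act _ (f _)) => v.
  move: (f (toP1 a%:~R _)) (f (toP1 b%:~R _)) (E c d) => w t k h1 h3.
  by apply: (eq_add_hyp h3); apply: (eq_add_hyp (esym h1)); zmod.
have hc := farey_connected hE.
apply/eqP; rewrite -subr_eq0; apply/eqP.
have -> : slash act phi g D - phi D = fgsum h (val D).
  rewrite /slash /phi /=.
  pose L (D : {freeg P1Q / int}) :=
    act (zr (g 0 0)) (fgsum f (freeg_map (mobius g) D)) - fgsum f D.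
  have hL : zmod_morphism L.
    by move=> x y; rewrite /L !raddfB /= actB; zmod.
  pose L' : {additive {freeg P1Q / int} -> M} :=
    HB.pack L (GRing.isZmodMorphism.Build _ _ _ hL).
  apply: (@freeg_ext _ _ L' (fgsum h)) => x /=.
  by rewrite /L fgsum_gen freeg_map_gen !fgsum_gen.
have -> : fgsum h (val D) = fgsum (fun=> h None) (val D).
  by apply: (@freeg_ext _ _ (fgsum _) (fgsum _)) => x /=; rewrite !fgsum_gen hc.
rewrite fgsum_cst (_ : deg _ = 0) ?mulr0z //.
by apply/eqP; exact: (valP D).
Qed.

Lemma modsymb_ofP e : is_manin p n act e -> is_modsymb act (modsymb_of act e) /\
  forall x y, in_Xn x y -> manin_of (modsymb_of act e) x y = e x y.
Proof.
by move=> he; exact: (epsilon_spec (inhabits (fun=> 0)) _ (modsymb_of_manin he)).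
Qed.

(** The matrix k = g' g^-1 lies in Gamma_0 with lower right entry l, so its upper left entry, which
    acts, is l^-1 modulo N. *)
Lemma modsymb_scale phi g g' (l : 'Z_N) : is_modsymb act phi ->
  \det g = 1 -> \det g' = 1 -> l \is a GRing.unit ->
  zr (g' 1 0) = l * zr (g 1 0) -> zr (g' 1 1) = l * zr (g 1 1) ->
  phi (div0_act g' div_inf_0) = act l (phi (div0_act g div_inf_0)).
Proof.
move=> [_ phiG] Dg Dg' ul e0 e1; pose k := g' *m adj2 g.
have Dk : \det k = 1 by rewrite det_mulmx det_adj2 Dg Dg' mulr1.
have k10 : zr (k 1 0) = 0.
  by rewrite mulmx2E !mx2E intrD !intrM mulrNz e0 e1; ring.
have hk : Gamma0 N k by split=> //; rewrite -(Zp_intr_eq0 hp hn); apply/eqP.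
have k11 : zr (k 1 1) = l.
  transitivity (l * zr (\det g)); last by rewrite Dg mulr1.
  by rewrite mulmx2E !mx2E det2E intrD intrB !intrM mulrNz e0 e1; ring.
have [_ kk uk] := Gamma0_Zp hk; rewrite k11 in kk.
have -> : g' = k *m g by rewrite -mulmxA mul_adj2mx // mulmx1.
rewrite div0_act_mulmx ?Dg // -[in RHS](phiG _ hk) /slash.
by rewrite -[RHS]/((act _ \o act _) _) -actM // mulrC kk act1.
Qed.

Lemma manin_of_eval phi g : is_modsymb act phi -> \det g = 1 ->
  phi (div0_act g div_inf_0) = manin_of phi (zr (g 1 0)) (zr (g 1 1)).
Proof.
move=> hphi Dg; have hX : in_Xn (zr (g 1 0)) (zr (g 1 1)).
  by apply: (in_Xn_int hp hn (a := g 0 0) (b := g 0 1)); rewrite -det2E.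
have [Dl l0 l1] := lift_SL2P hp hn hX.
by rewrite (modsymb_scale (l := 1) hphi Dl Dg) ?unitr1 ?mul1r ?act1 // ?l0 ?l1.
Qed.

(** The two- and three-term relations hold because the boundaries of the corresponding paths cancel
    already as divisors. *)
Lemma manin_of_manin phi : is_modsymb act phi -> is_manin p n act (manin_of phi).
Proof.
move=> hphi x y hX; have [Dg gx gy] := lift_SL2P hp hn hX.
have phiB : zmod_morphism phi by case: hphi.
pose phi' : {additive div0 -> M} := HB.pack phi (GRing.isZmodMorphism.Build _ _ _ phiB).
have phi0 (D : div0) : val D = 0 -> phi D = 0.
  by move=> D0; have -> : D = 0 by [apply: val_inj]; exact: (raddf0 phi').
have phiD (D D' : div0) : phi (D + D') = phi D + phi D' by exact: (raddfD phi').
set g := lift_SL2 x y in Dg gx gy.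
have -> : manin_of phi x y = phi (div0_act g div_inf_0) by [].
have ev (h : 'M[int]_2) x' y' : \det h = 1 -> zr (h 1 0) = x' -> zr (h 1 1) = y' ->
    manin_of phi x' y' = phi (div0_act h div_inf_0).
  by move=> Dh <- <-; rewrite (manin_of_eval hphi Dh).
split=> [l ul||].
- have [Dl l0 l1] := lift_SL2P hp hn (in_XnM hp hn ul hX).
  by rewrite /manin_of (modsymb_scale (l := l) hphi Dg Dl ul) // ?l0 ?l1 ?gx ?gy.
- rewrite (ev (mx2 (g 0 1) (- g 0 0) (g 1 1) (- g 1 0))) ?mx2E ?mulrNz ?gx ?gy //.
    rewrite -phiD; apply: phi0; rewrite div0_valD !div0_act_inf_0 !mx2E.
    by rewrite !mulrNz toP1N; zmod.
  by rewrite det_mx2 -Dg det2E; ring.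
rewrite (ev (mx2 (g 0 1) (- g 0 0 - g 0 1) (g 1 1) (- g 1 0 - g 1 1)));
  rewrite ?mx2E ?intrB ?mulrNz ?gx ?gy //; last by rewrite det_mx2 -Dg det2E; ring.
rewrite (ev (mx2 (- g 0 0 - g 0 1) (g 0 0) (- g 1 0 - g 1 1) (g 1 0)));
  rewrite ?mx2E ?intrB ?mulrNz ?gx ?gy //; last by rewrite det_mx2 -Dg det2E; ring.
rewrite -!phiD; apply: phi0; rewrite !div0_valD !div0_act_inf_0 !mx2E.
zmod.
Qed.

Lemma slash_Gamma0 phi m g d D : (0 < m)%N -> is_modsymb act phi -> Gamma0 N g ->
  double_coset N m d -> slash act phi (g *m d) D = slash act phi d D.
Proof.
move=> m0 [_ phiG] hg hd; have [d10 ud] := double_coset_Zp hd.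
have [_ _ ug] := Gamma0_Zp hg.
rewrite /slash mulmx2E intrD !intrM d10 mulr0 addr0 mulrC actM //=.
rewrite div0_act_mulmx ?(det_double_coset hd) ?eqz_nat -?lt0n //.
by congr (act _ _); exact: phiG.
Qed.

(** Sending each element of s to the one of s' in the same coset is a bijection, and by
    [slash_Gamma0] the summand depends only on the coset. *)
Lemma sum_coset_reps phi m s s' D : (0 < m)%N -> is_modsymb act phi ->
  is_coset_reps N m s -> is_coset_reps N m s' ->
  \sum_(d <- s) slash act phi d D = \sum_(d <- s') slash act phi d D.
Proof.
move=> m0 hphi [us sDC repP] [us' s'DC repP'].
have ex d : exists e, d \in s -> e \in s' /\ exists2 g, Gamma0 N g & d = g *m e.
  have [ds|dNs] := boolP (d \in s); last by exists d.
  by have [e [he _]] := repP' _ (sDC _ ds); exists e.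
have [r rP] := boolp.choice ex.
have eq_r : perm_eq (map r s) s'.
  have GK g d : Gamma0 N g -> adj2 g *m (g *m d) = d.
    by move=> [Dg _]; rewrite mulmxA mul_adj2mx // mul1mx.
  apply: uniq_perm => // [|e].
    rewrite map_inj_in_uniq // => d d' ds d's rdd'.
    have [_ [g hg dE]] := rP _ ds; have [_ [g' hg' dE']] := rP _ d's.
    have [e [_ e_uniq]] := repP _ (sDC _ ds).
    rewrite -(e_uniq d) ?(e_uniq d') //; split=> //; last first.
      by exists 1%:M; [exact: Gamma0_1 | rewrite mul1mx].
    exists (g *m adj2 g'); first exact: Gamma0M (Gamma0V _).
    by rewrite {1}dE {1}dE' -rdd' -mulmxA GK.
  apply/mapP/idP => [[d /rP[h _] ->] //|es'].
  have [d [[ds [g hg eE]] _]] := repP _ (s'DC _ es').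
  exists d => //; have [rs' [h hh dE]] := rP _ ds.
  have [e0 [_ e0_uniq]] := repP' _ (s'DC _ es').
  rewrite -(e0_uniq e) ?(e0_uniq (r d)) //; split=> //.
    by exists (g *m h); [exact: Gamma0M | rewrite -mulmxA -dE].
  by exists 1%:M; [exact: Gamma0_1 | rewrite mul1mx].
rewrite -(perm_big _ eq_r) /= big_map; apply: eq_big_seq => d ds.
have [rs' [g hg dE]] := rP _ ds.
by rewrite {1}dE; apply: (slash_Gamma0 _ m0) => //; exact: s'DC.
Qed.

(** Right multiplication by g permutes the cosets ([coset_reps_mulr]), and the sum does not depend
    on representatives. *)
Lemma hecke_modsymb_modsymb phi m : (0 < m)%N -> is_modsymb act phi ->
  is_coset_reps N m (coset_reps N m) -> is_modsymb act (hecke_modsymb act m phi).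
Proof.
move=> m0 hphi hs; have phiB : zmod_morphism phi by case: hphi.
split=> [D D'|g hg D].
  rewrite /hecke_modsymb -sumrB; apply: eq_bigr => d _; rewrite /slash -actB -phiB.
  by congr (act _ (phi _)); apply: val_inj; rewrite /= raddfB.
rewrite {1}/slash /hecke_modsymb act_sum.
rewrite -[RHS](sum_coset_reps D m0 hphi (coset_reps_mulr hs hg) hs) big_map.
apply: eq_big_seq => d ds; have [Dg _] := hg; have [_ sDC _] := hs.
have [g10 _ ug] := Gamma0_Zp hg; have [d10 ud] := double_coset_Zp (sDC _ ds).
rewrite /slash mulmx2E intrD !intrM g10 mulr0 addr0 mulrC actM //=.
by rewrite div0_act_mulmx ?Dg.
Qed.

(** Manin's trick: once h(inf - 0) is cut into unimodular paths k(inf - 0), each piece is the Manin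
    symbol at the bottom row of g k. *)
Lemma modsymb_decomp phi g h (ks : seq 'M[int]_2) : is_modsymb act phi ->
  \det g = 1 -> \det h != 0 -> all (fun k => \det k == 1) ks ->
  val (div0_act h div_inf_0) = \sum_(k <- ks) val (div0_act k div_inf_0) ->
  phi (div0_act (g *m h) div_inf_0) = \sum_(k <- ks) manin_of phi
    (zr (g 1 0) * zr (k 0 0) + zr (g 1 1) * zr (k 1 0))
    (zr (g 1 0) * zr (k 0 1) + zr (g 1 1) * zr (k 1 1)).
Proof.
move=> hphi Dg Dh /allP Dk hE; have phiB : zmod_morphism phi by case: hphi.
pose phi' : {additive div0 -> M} := HB.pack phi (GRing.isZmodMorphism.Build _ _ _ phiB).
have gB : zmod_morphism (div0_act g) by move=> D D'; apply: val_inj; rewrite /= raddfB.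
pose g' : {additive div0 -> div0} :=
  HB.pack (div0_act g) (GRing.isZmodMorphism.Build _ _ _ gB).
have {}hE : div0_act h div_inf_0 = \sum_(k <- ks) div0_act k div_inf_0.
  by apply: val_inj; rewrite raddf_sum.
rewrite div0_act_mulmx // hE -[div0_act g _]/(g' _) raddf_sum -[phi _]/(phi' _) raddf_sum.
apply: eq_big_seq => k ks_k /=.
have Dk1 : \det k = 1 by apply/eqP/Dk.
rewrite -div0_act_mulmx ?Dk1 // manin_of_eval // ?det_mulmx ?Dg ?Dk1 //.
by rewrite !mulmx2E !intrD !intrM.
Qed.

(** * T_q for a prime q different from p *)

Section HeckePrime.

Context (q : nat) (hq : prime q) (qp : q != p).

Lemma coprime_qN : coprime q N.
Proof. by rewrite coprimeXr // prime_coprime // dvdn_prime2. Qed.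

Lemma unit_qN : (q%:R : 'Z_N) \is a GRing.unit.
Proof. by rewrite unitZpE // coprime_sym coprime_qN. Qed.

(** An element l of SL_2(Z) with bottom row (x, y) adj(h) modulo N, so that l h has bottom row q (x,
    y). *)
Definition hecke_lift (x y : 'Z_N) (h : 'M[int]_2) : 'M[int]_2 :=
  lift_SL2 (x * zr (h 1 1) - y * zr (h 1 0)) (y * zr (h 0 0) - x * zr (h 0 1)).

Lemma hecke_liftP x y h : in_Xn x y -> h \in hermite q ->
  [/\ \det (hecke_lift x y h) = 1,
      zr (hecke_lift x y h 1 0) = x * zr (h 1 1) - y * zr (h 1 0)
    & zr (hecke_lift x y h 1 1) = y * zr (h 0 0) - x * zr (h 0 1)].
Proof.
move=> /(in_XnP hp hn)[u [v uv1]] hh; apply: (lift_SL2P hp hn).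
apply/(in_XnP hp hn).
exists (q%:R^-1 * (zr (h 0 0) * u + zr (h 0 1) * v)).
exists (q%:R^-1 * (zr (h 1 0) * u + zr (h 1 1) * v)).
transitivity (q%:R^-1 * (zr (\det h) * (u * x + v * y))).
  by rewrite det2E intrB !intrM; move: (q%:R^-1) => r; ring.
by rewrite uv1 mulr1 (det_hermite hh); exact: mulVr unit_qN.
Qed.

(** Modulo N the bottom row of l h g^-1 is q (x, y) g^-1 = (0, q), so this matrix lies in the double
    coset, and determinant q forces upper left entry 1: the character is trivial on it. Distinctness
    and exhaustiveness come from the Hermite forms. *)
Lemma hecke_coset_reps g : \det g = 1 ->
  let d h := hecke_lift (zr (g 1 0)) (zr (g 1 1)) h *m h *m adj2 g in
  is_coset_reps N q [seq d h | h <- hermite q] /\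
  {in hermite q, forall h, zr (d h 0 0) = 1}.
Proof.
move=> Dg; set x := zr (g 1 0); set y := zr (g 1 1) => d.
have hX : in_Xn x y.
  by apply: (in_Xn_int hp hn (a := g 0 0) (b := g 0 1)); rewrite -det2E.
have gK (A : 'M[int]_2) : A *m adj2 g *m g = A by rewrite -mulmxA mul_adj2mx // mulmx1.
have gVK (A : 'M[int]_2) : A *m g *m adj2 g = A by rewrite -mulmxA mulmx_adj2 // mulmx1.
have LK (h A : 'M[int]_2) : h \in hermite q ->
    adj2 (hecke_lift x y h) *m (hecke_lift x y h *m A) = A.
  by move=> hh; have [Dl _ _] := hecke_liftP hX hh; rewrite mulmxA mul_adj2mx // mul1mx.
have Dd h : h \in hermite q -> \det (d h) = q%:Z.
  move=> hh; have [Dl _ _] := hecke_liftP hX hh.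
  by rewrite /d !det_mulmx Dl (det_hermite hh) det_adj2 Dg mul1r mulr1.
have d1 h : h \in hermite q -> zr (d h 1 0) = 0 /\ zr (d h 1 1) = q%:R.
  move=> hh; have [_ l0 l1] := hecke_liftP hX hh.
  have -> : q%:R = zr (\det h) * zr (\det g) :> 'Z_N by rewrite Dg mulr1 (det_hermite hh).
  rewrite /d !mulmx2E !mx2E !det2E !(intrB, intrD, intrM, mulrNz) l0 l1 -/x -/y.
  by split; ring.
have dDC h : h \in hermite q -> double_coset N q (d h).
  move=> hh; apply: double_coset_det => //; [exact: coprime_qN | exact: Dd|].
  by rewrite -(Zp_intr_eq0 hp hn) (d1 _ hh).1.
have d_inj (h h' : 'M[int]_2) (k : 'M[int]_2) : h \in hermite q -> h' \in hermite q -> \det k = 1 ->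
    d h = k *m d h' -> h = h'.
  move=> hh hh' Dk e; have [Dl _ _] := hecke_liftP hX hh.
  have [Dl' _ _] := hecke_liftP hX hh'.
  apply: (hermite_uniq (k := adj2 (hecke_lift x y h) *m k *m hecke_lift x y h') hq hh hh').
    by rewrite !det_mulmx det_adj2 Dl Dk Dl' !mulr1.
  have := congr1 (mulmx^~ g) e; rewrite /d gK !mulmxA gK => e'.
  by rewrite -{1}[h](LK h) // e' -!mulmxA.
have d00 : {in hermite q, forall h, zr (d h 0 0) = 1}.
  move=> h hh; have [d0 dq] := d1 h hh.
  apply: (mulIr unit_qN); rewrite mul1r -{1}dq.
  have -> : q%:R = zr (\det (d h)) :> 'Z_N by rewrite Dd.
  by rewrite det2E intrB !intrM d0 mulr0 subr0.
split=> //; split=> [|_ /mapP[h hh ->]|A ADC]; [|exact: dDC|].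
  rewrite map_inj_in_uniq ?uniq_hermite // => h h' hh hh' e.
  by apply: (d_inj _ _ 1%:M) => //; rewrite ?det1 ?mul1mx.
have DA := det_double_coset ADC.
have [|h hh [k Dk Ak]] := @hermite_ex q (A *m g) hq; first by rewrite det_mulmx DA Dg mulr1.
have [Dl _ _] := hecke_liftP hX hh.
pose G := k *m adj2 (hecke_lift x y h).
have DG : \det G = 1 by rewrite det_mulmx det_adj2 Dk Dl.
have AE : A = G *m d h.
  by rewrite -[A]gVK Ak /G /d -!mulmxA LK.
exists (d h); split.
  split; first exact: map_f.
  exists G => //; split=> //; rewrite -(Zp_intr_eq0 hp hn).
  have [A10 _] := double_coset_Zp ADC; move: A10.
  by rewrite AE mulmx2E intrD !intrM (d1 _ hh).1 (d00 _ hh) mulr1 mulr0 addr0 => ->.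
move=> _ [/mapP[h' hh' ->] [k' [Dk' _] Ak']]; congr d.
apply: (d_inj _ _ (adj2 G *m k')) => //; first by rewrite det_mulmx det_adj2 DG Dk' mulr1.
by rewrite -mulmxA -Ak' AE mulmxA mul_adj2mx // mul1mx.
Qed.

Lemma coset_repsP : is_coset_reps N q (coset_reps N q).
Proof.
have [h _] := hecke_coset_reps (det1 _ 2).
exact: (epsilon_spec (inhabits [::]) _ (ex_intro _ _ h)).
Qed.

Lemma hecke_manin e : is_manin p n act e -> is_manin p n act (hecke p n act q e).
Proof.
move=> /modsymb_ofP[hphi _]; apply: manin_of_manin.
by apply: hecke_modsymb_modsymb coset_repsP => //; exact: prime_gt0.
Qed.

(** Evaluate on g(inf - 0) with the representatives adapted to g: the factor g^-1 cancels and no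
    character remains. *)
Lemma hecke_hermite e x y : is_manin p n act e -> in_Xn x y ->
  hecke p n act q e x y = \sum_(h <- hermite q)
    modsymb_of act e (div0_act (hecke_lift x y h *m h) div_inf_0).
Proof.
move=> he hX; have [hphi _] := modsymb_ofP he.
have [Dg gx gy] := lift_SL2P hp hn hX.
have [hs d00] := hecke_coset_reps Dg.
rewrite /hecke /manin_of /hecke_modsymb.
rewrite (sum_coset_reps _ (prime_gt0 hq) hphi coset_repsP hs) big_map.
apply: eq_big_seq => h hh; rewrite /slash d00 // act1 gx gy.
rewrite -div0_act_mulmx ?Dg // -[_ *m adj2 _ *m _]mulmxA.
by rewrite mul_adj2mx // mulmx1.
Qed.

End HeckePrime.

(** * Merel's formula for T_2 and T_3 *)

Lemma hecke_term e q h ks x y : prime q -> q != p -> is_manin p n act e ->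
  in_Xn x y -> h \in hermite q -> all (fun k => \det k == 1) ks ->
  val (div0_act h div_inf_0) = \sum_(k <- ks) val (div0_act k div_inf_0) ->
  let u := x * zr (h 1 1) - y * zr (h 1 0) in
  let v := y * zr (h 0 0) - x * zr (h 0 1) in
  modsymb_of act e (div0_act (hecke_lift x y h *m h) div_inf_0) =
  \sum_(k <- ks) e (u * zr (k 0 0) + v * zr (k 1 0)) (u * zr (k 0 1) + v * zr (k 1 1)).
Proof.
move=> hq qp he hX hh Dk hE u v; have [hphi eE] := modsymb_ofP he.
have [Dl l0 l1] := hecke_liftP hq qp hX hh.
rewrite (modsymb_decomp hphi Dl _ Dk hE); last first.
  by rewrite (det_hermite hh) eqz_nat -lt0n prime_gt0.
apply: eq_big_seq => k /(allP Dk)/eqP Dk1; rewrite l0 l1 eE //.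
have Dlk : \det (hecke_lift x y h *m k) = 1 by rewrite det_mulmx Dl Dk1.
move: (in_Xn_int hp hn (etrans (esym (det2E _)) Dlk)).
by rewrite !mulmx2E !intrD !intrM l0 l1.
Qed.

Lemma hecke_term_diag e q x y : prime q -> q != p -> is_manin p n act e -> in_Xn x y ->
  modsymb_of act e (div0_act (hecke_lift x y (mx2 q%:Z 0 0 1) *m mx2 q%:Z 0 0 1) div_inf_0)
  = e x (y *+ q).
Proof.
move=> hq qp he hX; rewrite (hecke_term (ks := [:: mx2 1 0 0 1]) hq qp he hX).
- rewrite big_seq1 !mx2E !(mulr0, mulr1, subr0, addr0, add0r).
  by rewrite mulr_natr.
- exact: mem_head.
- by rewrite /= det_mx2 mulr1 mulr0 subr0 eqxx.
by rewrite big_seq1 !div0_act_inf_0 !mx2E /toP1 eqxx.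
Qed.

Lemma hecke_term_upper e q (j : nat) ks x y : prime q -> q != p ->
  is_manin p n act e -> in_Xn x y -> (j < q)%N -> all (fun k => \det k == 1) ks ->
  freeg_gen (toP1 1%:~R 0%:~R) - freeg_gen (toP1 (- j%:Z)%:~R q%:Z%:~R)
    = \sum_(k <- ks) val (div0_act k div_inf_0) ->
  modsymb_of act e (div0_act (hecke_lift x y (mx2 1 (- j%:Z) 0 q%:Z) *m mx2 1 (- j%:Z) 0 q%:Z)
    div_inf_0)
  = \sum_(k <- ks) e (x *+ q * zr (k 0 0) + (x *+ j + y) * zr (k 1 0))
                     (x *+ q * zr (k 0 1) + (x *+ j + y) * zr (k 1 1)).
Proof.
move=> hq qp he hX ltj Dk hE; rewrite (hecke_term (ks := ks) hq qp he hX) //.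
- rewrite !mx2E !(mulr0, mulr1, subr0) mulrNz mulrN opprK mulr_natr mulr_natr.
  by rewrite [y + _]addrC.
- by rewrite inE; apply/orP; right; apply/mapP; exists j; rewrite ?mem_iota.
by rewrite div0_act_inf_0 !mx2E.
Qed.

(** The path from infinity to -1/2 is cut at 0; the other two Hermite matrices send inf - 0 to
    itself. *)
Lemma hecke2E e x y : 2%N != p -> is_manin p n act e -> in_Xn x y ->
  hecke p n act 2 e x y =
  e x (y *+ 2) + e (x *+ 2) y + e (x *+ 2) (x + y) + e (x + y) (y *+ 2).
Proof.
move=> p2 he hX; rewrite hecke_hermite // /hermite /= !big_cons big_nil addr0.
rewrite hecke_term_diag //.
rewrite (hecke_term_upper (ks := [:: mx2 1 0 0 1])) //; first last.
- by rewrite big_seq1 div0_act_inf_0 !mx2E /toP1 /= !mul0r.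
- by rewrite /= det_mx2.
rewrite (hecke_term_upper (ks := [:: mx2 1 0 0 1; mx2 0 (-1) 1 2])) //; first last.
- by rewrite !big_cons big_nil addr0 !div0_act_inf_0 !mx2E !addrA !subrK.
- by rewrite /= !det_mx2.
rewrite big_seq1 !big_cons big_nil addr0 -!addrA !mx2E.
by congr (_ + (e _ _ + (e _ _ + e _ _))); ring.
Qed.

(** The path from infinity to -1/3 is cut at 0, and the one to -2/3 at 0 and -1/2, consecutive
    points being Farey neighbours. *)
Lemma hecke3E e x y : 3%N != p -> is_manin p n act e -> in_Xn x y ->
  hecke p n act 3 e x y =
  e x (y *+ 3) + e (x + y) (y *+ 3) + e (x + y *+ 2) (y *+ 3) + e (x *+ 3) y
  + e (x *+ 3) (x + y) + e (x *+ 3) (x *+ 2 + y) + e (x *+ 2 + y) (x + y *+ 2).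
Proof.
move=> p3 he hX; rewrite hecke_hermite // /hermite /= !big_cons big_nil addr0.
rewrite hecke_term_diag //.
rewrite (hecke_term_upper (ks := [:: mx2 1 0 0 1])) //; first last.
- by rewrite big_seq1 div0_act_inf_0 !mx2E /toP1 /= !mul0r.
- by rewrite /= det_mx2.
rewrite (hecke_term_upper (ks := [:: mx2 1 0 0 1; mx2 0 (-1) 1 3])) //; first last.
- by rewrite !big_cons big_nil addr0 !div0_act_inf_0 !mx2E !addrA !subrK.
- by rewrite /= !det_mx2.
rewrite (hecke_term_upper (ks := [:: mx2 1 0 0 1; mx2 0 (-1) 1 2; mx2 (-1) (-2) 2 3])) //;
  first last.
- by rewrite !big_cons big_nil addr0 !div0_act_inf_0 !mx2E !addrA !subrK.
- by rewrite /= !det_mx2.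
rewrite big_seq1 !big_cons !big_nil !addr0 !mx2E.
transitivity (e x (y *+ 3) + (e (x *+ 3) y + (e (x *+ 3) (x + y) + e (x + y) (y *+ 3)
   + (e (x *+ 3) (x *+ 2 + y) + (e (x *+ 2 + y) (x + y *+ 2) + e (x + y *+ 2) (y *+ 3)))))).
  by rewrite -!addrA; congr (_ + (e _ _ + (e _ _ + (e _ _ + (e _ _ + (e _ _ + e _ _)))))); ring.
zmod.
Qed.

(** Multiplication by q and the action of l are additive and commute with all chi(m), the group of
    units being commutative. *)
Lemma is_manin_eisenstein e e' q (l : 'Z_N) : l \is a GRing.unit ->
  is_manin p n act e -> is_manin p n act e' ->
  is_manin p n act (fun x y => e' x y - (e x y *+ q + act l (e x y))).
Proof.
move=> ul he he' x y hX; have [e1 e2 e3] := he x y hX; have [e1' e2' e3'] := he' x y hX.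
have actMn m u : act m (u *+ q) = act m u *+ q.
  by elim: q => [|k IHk]; rewrite ?act0 // !mulrS actD IHk.
split=> [m um||].
- rewrite e1 // e1' // actB actD actMn; congr (_ - (_ + _)).
  by rewrite -[LHS]/((act l \o act m) _) -actM // mulrC actM.
- have h := congr1 (act l) e2; rewrite actD act0 in h.
  have hq := congr1 (fun u => u *+ q) e2; rewrite mulrnDl mul0rn in hq.
  move: h hq e2'; move: (e' x y) (e' y _) (act l (e x y)) (act l _).
  move: (e x y *+ q) (e y _ *+ q) => a b c d f g h hq h'.
  by apply: (eq_add_hyp (esym h)); apply: (eq_add_hyp (esym hq)); apply: (eq_add_hyp h'); zmod.
have h := congr1 (act l) e3; rewrite !actD act0 in h.
have hq := congr1 (fun u => u *+ q) e3; rewrite !mulrnDl mul0rn in hq.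
move: h hq e3'; move: (e' x y) (e' y _) (e' _ x).
move: (act l (e x y)) (act l (e y _)) (act l (e _ x)).
move: (e x y *+ q) (e y _ *+ q) (e _ x *+ q) => a b c a' b' c' a'' b'' c'' h hq h'.
by apply: (eq_add_hyp (esym h)); apply: (eq_add_hyp (esym hq)); apply: (eq_add_hyp h'); zmod.
Qed.

End ManinTheory.

Theorem theorem5p1 (p n : nat) (hp : prime p) (hn : (1 <= n)%N)
    (L : splittingFieldType rat) (z : L)
    (hz : (p ^ n).-primitive_root z) (hL : <<1; z>>%VS = {:L}%VS) :
  is_manin p n (sigmaK2 hz) (cyclo_symbol p z (p ^ n)) /\
  forall q : nat, q \in [:: 2%N; 3%N] -> q != p ->
    is_manin_inf p n (sigmaK2 (p := p) hz) (fun x y : 'Z_(p ^ n) =>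
      hecke p n (sigmaK2 hz) q (cyclo_symbol p z (p ^ n)) x y
      - (cyclo_symbol p z (p ^ n) x y *+ q
         + sigmaK2 hz q%:R (cyclo_symbol p z (p ^ n) x y))).
Proof.
have heM := cyclo_symbol_manin hp hn hz; split=> // q hq qp.
have pq : prime q by move: hq; rewrite !inE => /orP[]/eqP->.
have uq : (q%:R : 'Z_(p ^ n)) \is a GRing.unit by exact: unit_qN.
have hD := sigmaK2D (p := p) hz; have h1 := sigmaK2_1 hp hn hz.
have hM := sigmaK2M hp hn hz.
split; first by apply: is_manin_eisenstein => //; exact: hecke_manin.
move=> x y hX xy0.
have x0 : x != 0 by apply: contraNneq xy0 => ->; rewrite mul0r.
have y0 : y != 0 by apply: contraNneq xy0 => ->; rewrite mulr0.
(* By equivariance sigma_q e(x, y) = e(qx, qy), which puts the goal in the shape of the symbol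
   identities for T_2 and T_3. *)
apply/eqP; rewrite subr_eq0 -(cyclo_symbolM hp hn hz) // !mulr_natl; apply/eqP.
move: hq; rewrite !inE => /orP[]/eqP eq_q; rewrite eq_q in qp *.
- by rewrite (hecke2E hp hn hD h1 hM) // (cyclo_symbol_hecke2 hp hn hz).
- by rewrite (hecke3E hp hn hD h1 hM) // (cyclo_symbol_hecke3 hp hn hz).
Qed.
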